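(* Let $Q(r,s):=\frac{r^2}{4}+\frac{7rs}{2}+\frac{s^2}{4}+\frac{3r}{2}+\frac{5s}{2}+1$. As formal power series in $q$ whose coefficients are Laurent polynomials in $\zeta$, $$\sum_{\substack{n\ge0\\ m\in\mathbb Z}} \mathrm{ou}^*(m,n)\zeta^m q^n = \sum_{n\ge0} \left(-\zeta q,-\zeta^{-1}q;q^2\right)_n q^{2n+1},$$ and this series is also equal to each of the following three expressions: $$-\frac{1}{\left(q^2;q^2\right)_\infty}\sum_{n\in\mathbb Z} \frac{(-1)^nq^{3n^2+3n+1}}{1+\zeta q^{2n+1}} + \frac{1}{\left(q^2;q^2\right)_\infty}\sum_{n\in\mathbb Z} \frac{\zeta^{-n}q^{n^2+2n+1}}{1+\zeta q^{2n+1}},$$ $$\frac{q}{\left(q^2;q^2\right)_\infty}\left(\sum_{n,r\ge0}-\sum_{n,r<0}\right) (-1)^n\zeta^r q^{3n^2+3n+4nr+r^2+2r},$$ $$\frac{\left(-\zeta q,-\zeta^{-1}q;q^2\right)_\infty}{\left(q^2;q^2\right)_\infty^2}\left(\sum_{\substack{r,s\ge0\\ r\equiv s \,(\mathrm{mod}\, 2)}}-\sum_{\substack{r,s<0\\ r\equiv s\,(\mathrm{mod}\, 2)}}\right) \frac{(-1)^{\frac{r-s}{2}}q^{Q(r,s)}}{1+\zeta q^{r+s+1}}.$$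
   Context: An odd strongly unimodal sequence of weight $n$ is a sequence of odd positive integers of the form $a_1<\cdots<a_r<c>b_1>\cdots>b_s$ (with $r,s\ge 0$) such that $n=c+\sum_{j=1}^r a_j+\sum_{j=1}^s b_j$; $c$ is called the peak. The rank of the sequence is $r-s$. $\mathrm{ou}^*(m,n)$ denotes the number of odd strongly unimodal sequences of weight $n$ with rank $m$. Notation: $(a;q)_n:=\prod_{j=0}^{n-1}(1-aq^j)$ and $(a_1,\dots,a_\ell;q)_n:=(a_1;q)_n\cdots(a_\ell;q)_n$ for $n\in\mathbb N_0\cup\{\infty\}$. The sums over $n,r\ge 0$ and $n,r<0$ (and likewise $r,s$) run over pairs of integers that are both $\ge0$, respectively both $<0$; a difference of summation signs in parentheses means the difference of the two sums of the same summand. Rational functions are expanded in non-negative powers of $q$; in particular, for a negative odd integer $k$, $\frac{1}{1+\zeta q^{k}}=\frac{\zeta^{-1}q^{-k}}{1+\zeta^{-1}q^{-k}}$. *)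

(* Defs.v *)
From HB Require Import structures.
From mathcomp Require Import all_boot all_order all_algebra.
From mathcomp Require Import finmap ring.
From mathcomp Require Import mathcomp_extra boolp classical_sets cardinality.
From mathcomp Require Import fsbigop.

Set Implicit Arguments.
Unset Strict Implicit.
Unset Printing Implicit Defensive.

Import Order.TTheory GRing.Theory Num.Theory.
Local Open Scope ring_scope.

Record fps (R : Type) : Type := Fps { coefs : nat -> R }.

Lemma fpsP (R : Type) (f g : fps R) : coefs f =1 coefs g -> f = g.
Proof. by case: f g => [f] [g] /= /funext ->. Qed.

HB.instance Definition _ (R : Type) := gen_eqMixin (fps R).
HB.instance Definition _ (R : Type) := gen_choiceMixin (fps R).

Definition fps0 (R : nmodType) : fps R := Fps (fun=> 0).
Definition fps_opp (R : zmodType) (f : fps R) : fps R :=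
  Fps (fun n => - coefs f n).
Definition fps_add (R : nmodType) (f g : fps R) : fps R :=
  Fps (fun n => coefs f n + coefs g n).

Lemma fps_addA (R : nmodType) : associative (@fps_add R).
Proof. by move=> f g h; apply: fpsP => n; rewrite /= addrA. Qed.
Lemma fps_addC (R : nmodType) : commutative (@fps_add R).
Proof. by move=> f g; apply: fpsP => n; rewrite /= addrC. Qed.
Lemma fps_add0 (R : nmodType) : left_id (@fps0 R) (@fps_add R).
Proof. by move=> f; apply: fpsP => n; rewrite /= add0r. Qed.
Lemma fps_addN (R : zmodType) : left_inverse (@fps0 R) (@fps_opp R) (@fps_add R).
Proof. by move=> f; apply: fpsP => n; rewrite /= addNr. Qed.

HB.instance Definition _ (R : zmodType) := GRing.isZmodule.Build (fps R)
  (@fps_addA R) (@fps_addC R) (@fps_add0 R) (@fps_addN R).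

Definition fpsC (R : nmodType) (c : R) : fps R :=
  Fps (fun n => if n == 0%N then c else 0).

Definition fpsX (R : pzSemiRingType) : fps R := Fps (fun n => (n == 1%N)%:R).

Definition fps_mul (R : pzSemiRingType) (f g : fps R) : fps R :=
  Fps (fun n => \sum_(i < n.+1) coefs f i * coefs g (n - i)%N).

Definition fps_trunc (R : nzSemiRingType) (n : nat) (f : fps R) : {poly R} :=
  \poly_(i < n) coefs f i.

Lemma coefs_mul_trunc (R : nzSemiRingType) (m n : nat) (f g : fps R) :
  (n < m)%N -> coefs (fps_mul f g) n = (fps_trunc m f * fps_trunc m g)`_n.
Proof.
move=> nm; rewrite coefM; apply: eq_bigr => i _.
rewrite !coef_poly (leq_ltn_trans _ nm) ?leq_ord //.
by rewrite (leq_ltn_trans (leq_subr _ _) nm).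
Qed.

Lemma fps_mulC (R : comNzRingType) : commutative (@fps_mul R).
Proof.
by move=> f g; apply: fpsP => n; rewrite !(@coefs_mul_trunc _ n.+1) // mulrC.
Qed.

Lemma fps_mulA (R : comNzRingType) : associative (@fps_mul R).
Proof.
move=> f g h; apply: fpsP => n.
have -> : coefs (fps_mul f (fps_mul g h)) n =
    (fps_trunc n.+1 f * (fps_trunc n.+1 g * fps_trunc n.+1 h))`_n.
  rewrite coefM; apply: eq_bigr => i _; rewrite coef_poly ltn_ord.
  by rewrite (@coefs_mul_trunc _ n.+1) // ltnS leq_subr.
rewrite mulrA coefM; apply: eq_bigr => i _.
by rewrite (@coefs_mul_trunc _ n.+1) // coef_poly ltnS leq_subr.
Qed.

Lemma fps_mul1 (R : comNzRingType) : left_id (fpsC (1 : R)) (@fps_mul R).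
Proof.
move=> f; apply: fpsP => n; rewrite /= big_ord_recl /= mul1r subn0 big1 ?addr0//.
by move=> i _; rewrite mul0r.
Qed.

Lemma fps_mulDl (R : comNzRingType) :
  left_distributive (@fps_mul R) (@fps_add R).
Proof.
move=> f g h; apply: fpsP => n; rewrite /= -big_split.
by apply: eq_bigr => i _; rewrite /= mulrDl.
Qed.

Lemma fps_one_neq0 (R : comNzRingType) : fpsC (1 : R) != 0.
Proof.
by apply/eqP => /(congr1 (fun f => coefs f 0%N)) /eqP; rewrite /= oner_eq0.
Qed.

HB.instance Definition _ (R : comNzRingType) :=
  GRing.Zmodule_isComNzRing.Build (fps R)
    (@fps_mulA R) (@fps_mulC R) (@fps_mul1 R) (@fps_mulDl R) (@fps_one_neq0 R).

(* The units are all the invertible series, so that [f^-1], [f / g] and [f ^ k]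
   with [k : int] have their ring-theoretic meaning; see [fps_unit1] below. *)
Definition fps_unit (R : comNzRingType) : {pred fps R} :=
  [pred f : fps R | `[< exists g : fps R, g * f = 1 >]].

Definition fps_inv (R : comNzRingType) (f : fps R) : fps R :=
  if pselect (exists g : fps R, g * f = 1) is left e then sval (cid e) else f.

Lemma fps_mulVx (R : comNzRingType) :
  {in @fps_unit R, left_inverse 1 (@fps_inv R) *%R}.
Proof.
move=> f /asboolP ef; rewrite /fps_inv.
by case: pselect => [e|/(_ ef)//]; case: (cid e).
Qed.

Lemma fps_unitPl (R : comNzRingType) (f g : fps R) : g * f = 1 -> fps_unit f.
Proof. by move=> gf; apply/asboolP; exists g. Qed.

Lemma fps_inv_out (R : comNzRingType) :
  {in [predC @fps_unit R], @fps_inv R =1 id}.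
Proof.
move=> f /asboolP nf; rewrite /fps_inv.
by case: pselect.
Qed.

HB.instance Definition _ (R : comNzRingType) :=
  GRing.ComNzRing_hasMulInverse.Build (fps R)
    (@fps_mulVx R) (@fps_unitPl R) (@fps_inv_out R).

Lemma fps_coef0X (R : comNzRingType) (f : fps R) (i n : nat) :
  coefs f 0%N = 0 -> (n < i)%N -> coefs (f ^+ i) n = 0.
Proof.
move=> f0; elim: i n => // i IH n; rewrite ltnS => ni.
rewrite exprS /= big_ord_recl /= f0 mul0r add0r big1 // => j _.
rewrite IH ?mulr0 //; case: n j ni => [|n] j ni; first by case: j.
by rewrite /= /bump /= add1n subSS (leq_ltn_trans (leq_subr _ _)).
Qed.

Lemma fps_unit1 (R : comNzRingType) (f : fps R) :
  coefs f 0%N = 1 -> f \is a GRing.unit.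
Proof.
move=> f1; pose g := 1 - f.
have g0 : coefs g 0%N = 0 by rewrite /= f1 subrr.
pose S n := \sum_(i < n) g ^+ i.
have SE n k : (k < n)%N -> coefs (S n) k = coefs (S k.+1) k.
  elim: n => // n IH; rewrite ltnS leq_eqVlt => /predU1P[->//|kn].
  by rewrite /S big_ord_recr /= (fps_coef0X g0 kn) addr0 IH.
apply/asboolP; exists (Fps (fun n => coefs (S n.+1) n)); apply: fpsP => n.
have -> : coefs (Fps (fun n => coefs (S n.+1) n) * f) n = coefs (S n.+1 * f) n.
  by apply: eq_bigr => i _; rewrite [coefs (S n.+1) i]SE //= ltn_ord.
have -> : S n.+1 * f = 1 - g ^+ n.+1.
  rewrite -[in RHS](expr1n _ n.+1) subrXX (_ : f = 1 - g); last first.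
    by rewrite /g opprB addrC subrK.
  by rewrite mulrC; congr (_ * _); apply: eq_bigr => i _; rewrite expr1n mul1r.
by rewrite /= (fps_coef0X g0) // oppr0 addr0.
Qed.

(* Coefficientwise sum of a family; [\sum_(i \in A)] is the sum over the
   support, so this is meaningful for families in which every power of the
   variable occurs with a nonzero coefficient only finitely often. *)
Definition fps_sum (R : nmodType) (I : choiceType) (A : set I)
    (F : I -> fps R) : fps R :=
  Fps (fun N => \sum_(i \in A) coefs (F i) N).

(* Coefficientwise limit: the eventually constant value of each coefficient. *)
Definition fps_lim (R : nmodType) (u : nat -> fps R) : fps R :=
  Fps (fun N => xget 0 [set c | exists M : nat,
                          forall n : nat, (M <= n)%N -> coefs (u n) N = c]).

(* (a_1, ..., a_l; x)_n for s = [:: a_1; ...; a_l]. *)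
Definition qpoch (R : comNzRingType) (s : seq (fps R)) (x : fps R) (n : nat) :
    fps R :=
  \prod_(a <- s) \prod_(j < n) (1 - a * x ^+ j).

Definition qpoch_inf (R : comNzRingType) (s : seq (fps R)) (x : fps R) : fps R :=
  \prod_(a <- s) fps_lim (qpoch [:: a] x).

Notation "p %:F" := (@FracField.tofrac {poly int} p) : ring_scope.

(* Z[X, X^-1] as a subring of the fraction field of Z[X]. *)
Definition laurent_pred : {pred {fraction {poly int}}} :=
  [pred x : {fraction {poly int}} |
    `[< exists (p : {poly int}) (k : nat), x = p%:F / 'X%:F ^+ k >]].

Lemma laurentP (x : {fraction {poly int}}) :
  reflect (exists (p : {poly int}) (k : nat), x = p%:F / 'X%:F ^+ k)
          (x \in laurent_pred).
Proof. exact: asboolP. Qed.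

Lemma tofracX_neq0 (k : nat) : 'X%:F ^+ k != 0.
Proof. by rewrite expf_neq0 // tofrac_eq0 polyX_eq0. Qed.

Fact laurent_subring : subring_closed laurent_pred.
Proof.
split.
- by apply/laurentP; exists 1, 0%N; rewrite expr0 divr1 tofrac1.
- move=> _ _ /laurentP[p [k ->]] /laurentP[r [l ->]]; apply/laurentP.
  exists (p * 'X^l - r * 'X^k), (k + l)%N.
  rewrite tofracB !tofracM !tofracXn exprD -mulNr addf_div ?tofracX_neq0 //.
  by rewrite mulNr.
- move=> _ _ /laurentP[p [k ->]] /laurentP[r [l ->]]; apply/laurentP.
  by exists (p * r), (k + l)%N; rewrite tofracM exprD mulf_div.
Qed.

HB.instance Definition _ :=
  GRing.isSubringClosed.Build {fraction {poly int}} laurent_pred laurent_subring.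

Record laurent : Type := Laurent {
  laurent_val :> {fraction {poly int}};
  laurent_valP : laurent_val \in laurent_pred }.

HB.instance Definition _ := [isSub for laurent_val].
HB.instance Definition _ := [Choice of laurent by <:].
HB.instance Definition _ := [SubChoice_isSubComNzRing of laurent by <:].

Fact laurentX_subproof : 'X%:F \in laurent_pred.
Proof. by apply/laurentP; exists 'X, 0%N; rewrite expr0 divr1. Qed.

Definition laurentX : laurent := Laurent laurentX_subproof.

Fact laurentXV_subproof : 'X%:F^-1 \in laurent_pred.
Proof. by apply/laurentP; exists 1, 1%N; rewrite expr1 tofrac1 div1r. Qed.

Definition laurentXV : laurent := Laurent laurentXV_subproof.

Definition q : fps laurent := fpsX laurent.
Definition zeta : fps laurent := fpsC laurentX.

Lemma zeta_unit : zeta \is a GRing.unit.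
Proof.
apply/asboolP; exists (fpsC laurentXV); apply: fpsP => n.
have XVX : laurentXV * laurentX = 1.
  by apply: val_inj; rewrite /= mulVf // -[X in X != _]expr1 tofracX_neq0.
rewrite /= big_ord_recl /= subn0 big1 ?addr0; last by move=> i _; rewrite mul0r.
by case: n => [|n] //=; rewrite mulr0.
Qed.

(* 1 / (1 + zeta q^k) for odd k, expanded in nonnegative powers of q. *)
Definition inv1Dzq (k : int) : fps laurent :=
  if 0 <= k then (1 + zeta * q ^ k)^-1
  else (zeta^-1 * q ^ (- k)) / (1 + zeta^-1 * q ^ (- k)).

Definition odd_sunimodal (a : seq nat) (c : nat) (b : seq nat) : bool :=
  [&& all odd (a ++ c :: b), sorted ltn (rcons a c) & sorted gtn (c :: b)].

Definition ou_set (m : int) (n : nat) : set (seq nat) :=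
  [set s | exists a c b, [/\ s = a ++ c :: b, odd_sunimodal a c b,
                             sumn s = n & (size a)%:Z - (size b)%:Z = m]].

Definition ou (m : int) (n : nat) : nat := #|` fset_set (ou_set m n)|.

Lemma finite_ou_set (m : int) (n : nat) : finite_set (ou_set m n).
Proof.
pose T := {k : 'I_n.+1 & k.-tuple 'I_n.+1}.
pose h (t : T) : seq nat := [seq val i | i <- val (tagged t)].
apply: (@sub_finite_set _ _ (h @` [set: T])); last first.
  exact/finite_image/finite_finset.
move=> s [a] [c] [b] [sE /and3P[oddl _ _] sn _].
rewrite -{}sE in oddl.
have szs : (size s <= sumn s)%N.
  elim: s oddl {sn} => //= x s IH /andP[ox /IH]; rewrite -add1n; apply: leq_add.
  by case: x ox.
have les x : x \in s -> (x <= sumn s)%N.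
  elim: s {oddl sn szs} => //= y s IH; rewrite inE => /predU1P[->|/IH].
    exact: leq_addr.
  by move/leq_trans; apply; apply: leq_addl.
rewrite sn in szs les.
have tsz : size [seq (inord x : 'I_n.+1) | x <- s] == Ordinal (szs : (size s < n.+1)%N).
  by rewrite size_map.
exists (existT (fun k : 'I_n.+1 => k.-tuple 'I_n.+1) _ (Tuple tsz)) => //.
rewrite /h /= -map_comp -[RHS]map_id; apply/eq_in_map => x /les xn /=.
by rewrite inordK.
Qed.

Definition Qrat (r s : int) : rat :=
  let r' := r%:~R in let s' := s%:~R in
  r' ^+ 2 / 4 + 7 * r' * s' / 2 + s' ^+ 2 / 4 + 3 * r' / 2 + 5 * s' / 2 + 1.

(* Qrat r s is an integer when r = s mod 2, see [QexpE]. *)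
Definition Qexp (r s : int) : int := Num.floor (Qrat r s).

Lemma QexpE (r s : int) : (r = s %[mod 2])%Z -> (Qexp r s)%:~R = Qrat r s.
Proof.
move=> rs; apply/eqP; rewrite -intrEfloor.
have [k ->] : exists k : int, r = s + 2 * k.
  exists ((r %/ 2)%Z - (s %/ 2)%Z).
  rewrite {1}(divz_eq r 2) {1}(divz_eq s 2) rs mulrBr; ring.
have -> : Qrat (s + 2 * k) s
  = (4 * s ^+ 2 + 8 * s * k + k ^+ 2 + 4 * s + 3 * k + 1)%:~R.
  by rewrite /Qrat !(rmorphD, rmorphM, rmorphXn) /=; field.
exact: intr_int.
Qed.

(* Main.v *)
(* Write x = q^2 and let P_n = (-zeta q, -zeta^-1 q; x)_n.

   Combinatorial side: for a sequence with peak 2n+1, the two flanks are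
   arbitrary sets of odd numbers below the peak, with generating functions the
   two factors of P_n.

   Hecke-type series: the finite Jacobi triple product expands P_n in powers of
   zeta with Gauss binomials as coefficients, so the coefficient of zeta^r in S
   is, up to a power of q, A_{2|r|} where A_N = sum_m x^m [2m+N; m]_x. The two
   Pascal rules give A_{N+1} - A_N = x^(N+3) (A_{N+3} - x A_{N+4}). The series
   sum_n (-1)^n x^(3n(n+1)/2 + nN), divided by (x; x)_oo, satisfies the same
   recurrence and has the same limit as N grows, so it equals A_N.

   Lerch-type sums: for each n, the n-th terms of the two sums differ by a
   multiple of (1 - (-y)^n) / (1 + y), y = zeta^(+-1) q^(2n+1), which is a finite
   geometric sum; these are the antidiagonals of the Hecke-type series.

   Indefinite theta series: the constant sequence 1 is the beta-side of a
   Bailey pair relative to x whose alpha-side is bailey_alpha, and P_n x^n is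
   one half of a conjugate Bailey pair, because the sum over n telescopes.
   Partial fractions in zeta then produce the stated double sum. *)

Require Import Defs.
From HB Require Import structures.
From mathcomp Require Import all_boot all_order all_algebra.
From mathcomp Require Import finmap ring zify.
From mathcomp Require Import mathcomp_extra boolp classical_sets cardinality.
From mathcomp Require Import fsbigop.

Set Implicit Arguments.
Unset Strict Implicit.
Unset Printing Implicit Defensive.

Import Order.TTheory GRing.Theory Num.Theory.
Local Open Scope classical_set_scope.
Local Open Scope ring_scope.

(** * q-factorials and Bailey pairs *)

Lemma sum_antidiag (V : nmodType) (F : nat -> nat -> V) (n : nat) :
  \sum_(r < n) \sum_(i < r.+1) F i (r - i)%N
  = \sum_(j < n) \sum_(i < (n - j)%N) F i j.
Proof.
elim: n => [|n IH]; first by rewrite !big_ord0.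
rewrite big_ord_recr IH [RHS]big_ord_recr /= subSn // subnn.
under [in RHS]eq_bigr => j _ do rewrite subSn ?(ltnW (ltn_ord j))// big_ord_recr.
rewrite big_split /= -addrA; congr (_ + _).
rewrite [LHS](reindex_inj rev_ord_inj) big_ord_recr /= subSS subnn subn0.
congr (_ + _); last by rewrite big_ord1.
apply: eq_bigr => j _; rewrite subSS; congr (F _ _).
by move: (ltn_ord j); lia.
Qed.

Section QFactorial.
Variables (R : comUnitRingType) (x : R).
Hypothesis x_unit : forall n, 1 - x ^+ n.+1 \is a GRing.unit.

(** This is (x; x)_n; under [x_unit] all of these are units, so that [qfactV] is a true inverse. *)
Definition qfact (n : nat) : R := \prod_(j < n) (1 - x ^+ j.+1).
Definition qfactV (n : nat) : R := (qfact n)^-1.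

Lemma qfact0 : qfact 0 = 1. Proof. by rewrite /qfact big_ord0. Qed.

Lemma qfactS n : qfact n.+1 = qfact n * (1 - x ^+ n.+1).
Proof. by rewrite /qfact big_ord_recr. Qed.

Lemma qfact_unit n : qfact n \is a GRing.unit.
Proof. exact: rpred_prod. Qed.

Lemma qfactV0 : qfactV 0 = 1. Proof. by rewrite /qfactV qfact0 invr1. Qed.

Lemma qfactVS n : qfactV n = qfactV n.+1 * (1 - x ^+ n.+1).
Proof. by rewrite /qfactV qfactS invrM ?qfact_unit// mulrAC mulVr// mul1r. Qed.

Lemma qfactK n : qfact n * qfactV n = 1.
Proof. exact/mulrV/qfact_unit. Qed.

(** With n = r + i the two [qfactV] factors are 1/(x; x)_(n-r) and 1/(x; x)_(n+r+1). Since y z = x,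
    even the truncated sums have product form after multiplication by (1 - y x^r)(1 - z x^r): with a
    = x^r and b = x^m, the induction step is (1 - b x)(1 - a^2 b x^2) + b x (1 - y a)(1 - z a) = (1
    - y a b x)(1 - z a b x). *)
Lemma conjugate_bailey_pair (y z : R) (r m : nat) : y * z = x ->
  let P n := \prod_(j < n) ((1 - y * x ^+ j) * (1 - z * x ^+ j)) in
  (\sum_(i < m.+1) P (r + i)%N * x ^+ (r + i) * qfactV i * qfactV (r + r + i).+1)
    * ((1 - y * x ^+ r) * (1 - z * x ^+ r))
  = x ^+ r * P (r + m).+1 * qfactV m * qfactV (r + r + m).+1.
Proof.
move=> yz P; have PS n : P n.+1 = P n * ((1 - y * x ^+ n) * (1 - z * x ^+ n)).
  by rewrite /P big_ord_recr.
elim: m => [|m IH].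
  by rewrite big_ord_recr big_ord0 /= !addn0 PS; ring.
rewrite big_ord_recr /= mulrDl IH !addnS [P (r + m).+2]PS.
rewrite [qfactV m]qfactVS [qfactV (r + r + m).+1]qfactVS !exprS !exprD.
move: (P (r + m).+1) (qfactV m.+1) (qfactV _.+2) (x ^+ r) (x ^+ m) => p v w a b.
by rewrite -yz; ring.
Qed.

Definition sgnq (i : nat) : R := (-1) ^+ i * x ^+ 'C(i, 2).

Lemma sgnq0 : sgnq 0 = 1. Proof. by rewrite /sgnq mulr1. Qed.

Lemma sgnqS i : sgnq i.+1 = - (x ^+ i * sgnq i).
Proof. by rewrite /sgnq binS bin1 exprD exprS; ring. Qed.

(** Entry (L, j) of the product of the Bailey matrix 1/((x; x)_(L-r) (x; x)_(L+r+1)) with its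
    inverse, where L = j + d and r = j + s. *)
Lemma bailey_orthogonality (j d : nat) :
  \sum_(s < d.+1) (1 - x ^+ (j + s).*2.+1) * sgnq s * qfact (j.*2 + s)
    * qfactV s * qfactV (d - s) * qfactV (j.*2 + d + s).+1
  = (d == 0%N)%:R.
Proof.
case: d => [|d].
  rewrite big_ord_recr big_ord0 /= add0r !addn0 sgnq0 !qfactV0 !mulr1.
  by rewrite [X in X * _]mulrC -qfactS qfactK.
rewrite /=.
(* The sum times [1 - x^(d+1)] telescopes, with partial sums [- T m]. *)
pose T s := sgnq s.+1 * qfact (j.*2 + s).+1 * qfactV s * qfactV (d.+1 - s)
  * (1 - x ^+ (d.+1 - s)) * qfactV (j.*2 + d.+1 + s).+1.
suff H m : (m <= d.+1)%N -> (1 - x ^+ d.+1) *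
  (\sum_(s < m.+1) (1 - x ^+ (j + s).*2.+1) * sgnq s * qfact (j.*2 + s)
    * qfactV s * qfactV (d.+1 - s) * qfactV (j.*2 + d.+1 + s).+1) = - T m.
  (* At m = d + 1 the factor 1 - x^(d+1-m) of [T m] vanishes. *)
  apply: (mulrI (x_unit d)); rewrite mulr0 H // /T subnn expr0 subrr.
  by rewrite mulr0 mul0r oppr0.
elim: m => [|m IH] md.
  rewrite big_ord_recr big_ord0 /= add0r /T !addn0 subn0 qfactS sgnqS sgnq0.
  by rewrite expr0; ring.
rewrite big_ord_recr /= mulrDr IH ?(ltnW md)// /T.
have [e ->] : exists e, d = (m + e)%N by exists (d - m)%N; lia.
have -> : ((m + e).+1 - m = e.+1)%N by lia.
have -> : ((m + e).+1 - m.+1 = e)%N by lia.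
rewrite ?addnS ?addSn -!addnn ?addnS ?addSn.
rewrite [qfactV m]qfactVS [qfactV e]qfactVS (qfactVS (_ + _ + _ + _).+2).
rewrite [sgnq m.+2]sgnqS !sgnqS !qfactS.
rewrite !exprS !exprD.
move: (qfact _) (qfactV m.+1) (qfactV e.+1) (qfactV _) (sgnq m) => p v w u s.
move: (x ^+ j) (x ^+ m) (x ^+ e) => a b c.
ring.
Qed.

(** The inverse Bailey matrix applied to the constant sequence 1, with i = n - j as summation index;
    the factor 1 - x^(2n+1) of the alpha-side is kept apart. *)
Definition bailey_alpha (n : nat) : R :=
  \sum_(i < n.+1) sgnq i * qfact (n.*2 - i) * qfactV i.

Lemma bailey_alpha0 : bailey_alpha 0 = 1.
Proof.
by rewrite /bailey_alpha big_ord_recr big_ord0 /= sgnq0 qfactV0 qfact0; ring.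
Qed.

(** Unrolling this recurrence turns [bailey_alpha n] into 2n + 1 signed powers of x without
    denominators, two new ones per step. *)
Lemma bailey_alphaS (n : nat) :
  bailey_alpha n.+1 = x ^+ (4 * n + 3) * bailey_alpha n
    + sgnq n.+1 * (x ^+ n.+1 + x ^+ n.+1.*2).
Proof.
pose t n i := sgnq i * qfact (n.*2 - i) * qfactV i.
(* q-Zeilberger certificate of the recurrence. *)
pose G m := sgnq m * (x ^+ n.+1.*2 - 1 + x ^+ (n.+1.*2 - m))
  * qfact (n.*2.+1 - m) * (qfactV m * (1 - x ^+ m)).
have H m : (m <= n.+1)%N ->
    \sum_(i < m) t n.+1 i = x ^+ (4 * n + 3) * (\sum_(i < m) t n i) + G m.
  elim: m => [|m IH] mn.
    by rewrite !big_ord0 /G expr0 subrr !mulr0 addr0.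
  rewrite !big_ord_recr /= IH ?(ltnW mn)// {IH}.
  suff: G m + t n.+1 m = x ^+ (4 * n + 3) * t n m + G m.+1.
    by rewrite mulrDr -!addrA => ->.
  rewrite /G /t.
  have [e En] : exists e, n.*2 = (m + e)%N by exists (n.*2 - m)%N; lia.
  have -> : (4 * n + 3 = m + e + m + e + 3)%N by lia.
  have -> : (n.+1.*2 = m + e + 2)%N by lia.
  rewrite En.
  have -> : (m + e + 2 - m = e.+2)%N by lia.
  have -> : (m + e + 2 - m.+1 = e.+1)%N by lia.
  have -> : ((m + e).+1 - m = e.+1)%N by lia.
  have -> : ((m + e).+1 - m.+1 = e)%N by lia.
  have -> : (m + e - m = e)%N by lia.
  rewrite [qfactV m]qfactVS sgnqS !qfactS !exprD !exprS.
  move: (qfact _) (qfactV m.+1) (sgnq m) => p v s.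
  by move: (x ^+ m) (x ^+ e) => a b; ring.
rewrite /bailey_alpha big_ord_recr /= -/(t n.+1) (H n.+1) // -addrA.
congr (_ + _); rewrite /G /t.
have -> : (n.+1.*2 - n.+1 = n.+1)%N by lia.
have -> : (n.*2.+1 - n.+1 = n)%N by lia.
rewrite -[RHS]mulr1 -[X in _ = _ * X](qfactK n.+1) qfactS.
move: (qfactV n.+1) (x ^+ n.+1) => v a.
by ring.
Qed.

(** Grouping the double sum by j = r - i makes each inner sum an instance of [bailey_orthogonality]
    with d = L - j, so only j = L contributes. *)
Lemma bailey_pair1 (L : nat) :
  \sum_(r < L.+1) (1 - x ^+ r.*2.+1) * bailey_alpha r
    * qfactV (L - r) * qfactV (L + r).+1 = 1.
Proof.
pose F i j := (1 - x ^+ (j + i).*2.+1) * sgnq i * qfact (j.*2 + i)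
  * qfactV i * qfactV (L - (j + i)) * qfactV (L + (j + i)).+1.
under eq_bigr => r _.
  have -> : (1 - x ^+ r.*2.+1) * bailey_alpha r * qfactV (L - r)
      * qfactV (L + r).+1 = \sum_(i < r.+1) F i (r - i)%N.
    rewrite /bailey_alpha mulr_sumr !mulr_suml; apply: eq_bigr => i _.
    have ir : (i <= r)%N by rewrite -ltnS.
    rewrite /F (subnK ir).
    have -> : (r.*2 - i = (r - i).*2 + i)%N by move: (ltn_ord i); lia.
    by ring.
  over.
rewrite sum_antidiag big_ord_recr /= big1 ?add0r => [|j _].
  rewrite subSnn big_ord1 /F.
  have := bailey_orthogonality L 0.
  by rewrite big_ord1 !addn0 subnn addnn.
have jL := ltn_ord j.
have := bailey_orthogonality j (L - j).
have -> : (L - j == 0)%N = false by lia.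
rewrite -subSn ?(ltnW jL) // => /(etrans _); apply; apply: eq_bigr => s _.
have := ltn_ord s => sL; rewrite /F.
have -> : (L - (j + s) = L - j - s)%N by lia.
by have -> : (L + (j + s) = j.*2 + (L - j) + s)%N by lia.
Qed.

End QFactorial.

(** * Gauss binomials *)

Section GaussBinomial.
Variables (R : comUnitRingType) (x : R).

(** The Gauss binomial [n; k]_x, defined through Pascal's rule so that nothing has to be
    inverted. *)
Fixpoint gauss (n k : nat) : R :=
  match n, k with
  | _, 0 => 1
  | 0, _.+1 => 0
  | n'.+1, k'.+1 => gauss n' k' + x ^+ k'.+1 * gauss n' k'.+1
  end.

Lemma gaussn0 n : gauss n 0 = 1. Proof. by case: n. Qed.

Lemma gaussS n k :
  gauss n.+1 k.+1 = gauss n k + x ^+ k.+1 * gauss n k.+1.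
Proof. by []. Qed.

Lemma gauss_small n k : (n < k)%N -> gauss n k = 0.
Proof.
elim: n k => [|n IH] [|k] //= nk.
by rewrite !IH ?mulr0 ?addr0 // ltnW.
Qed.

(** The mirror image of the defining Pascal rule. The two rules together drive both the triple
    product and the recurrence of the central columns. *)
Lemma gaussSr n k : (k <= n)%N ->
  gauss n.+1 k.+1 = x ^+ (n - k) * gauss n k + gauss n k.+1.
Proof.
elim: n k => [|n IH] [|k] // kn.
- by rewrite /= mulr0 expr0 mul1r.
- by rewrite gaussS [in LHS]IH // [in RHS]gaussS !gaussn0 !subn0 !exprS; ring.
- rewrite gaussS subSS; move: kn; rewrite ltnS leq_eqVlt => /predU1P[->|kn].
    by rewrite subnn [gauss _ n.+2]gauss_small//; ring.
  rewrite [in LHS](IH _ (ltnW kn)) [in LHS](IH _ kn).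
  rewrite [gauss n.+1 k.+1]gaussS [gauss n.+1 k.+2]gaussS.
  rewrite [(n - k)%N](_ : _ = (n - k.+1).+1) ?exprS; first ring.
  by lia.
Qed.

Lemma gauss_qfact m n : gauss (m + n) m * (qfact x m * qfact x n) = qfact x (m + n).
Proof.
elim: m n => [|m IH] n; first by rewrite gaussn0 qfact0 !mul1r.
elim: n => [|n IHn].
  have := IH 0%N; rewrite !addn0 => H.
  rewrite gaussS [gauss m m.+1]gauss_small // mulr0 addr0 qfactS -[in RHS]H; ring.
have -> : (m.+1 + n.+1 = (m.+1 + n).+1)%N by lia.
rewrite gaussS mulrDl.
have -> : gauss (m.+1 + n) m * (qfact x m.+1 * qfact x n.+1)
    = qfact x (m.+1 + n) * (1 - x ^+ m.+1).
  by rewrite addSnnS -IH [qfact x m.+1]qfactS; ring.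
rewrite [qfact x n.+1]qfactS.
have -> : x ^+ m.+1 * gauss (m.+1 + n) m.+1 *
     (qfact x m.+1 * (qfact x n * (1 - x ^+ n.+1)))
   = qfact x (m.+1 + n) * (x ^+ m.+1 * (1 - x ^+ n.+1)) by rewrite -IHn; ring.
by rewrite qfactS -addnS exprD; ring.
Qed.

End GaussBinomial.

(** The symmetry exchanges the two Pascal rules, so a double induction suffices, without dividing by
    q-factorials that may fail to be units. *)
Lemma gauss_sym (R : comUnitRingType) (x : R) (m n : nat) :
  gauss x (m + n) m = gauss x (m + n) n.
Proof.
elim: m n => [|m IH] n.
  rewrite gaussn0; elim: n => // n IHn.
  by rewrite gaussS -IHn [gauss _ _ n.+1]gauss_small// mulr0 addr0.
elim: n => [|n IHn].
  rewrite gaussn0 addn0; elim: m.+1 => // k IHk.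
  by rewrite gaussS IHk [gauss _ _ k.+1]gauss_small// mulr0 addr0.
rewrite addSn gaussSr; last by lia.
rewrite gaussS IH -addSnnS IHn.
by rewrite addrC; congr (_ + _ ^+ _ * _); lia.
Qed.

(** * Finite form of the Jacobi triple product *)

Definition sqdist (k b : nat) : nat := ((k - b) + (b - k)) ^ 2.

Section FiniteJacobi.
Variables (R : comUnitRingType) (q z : R).

(** [sqdist k b] is (k - b)^2, one of its truncated differences being 0. The second product has
    factors z + q^(2j+1) rather than 1 + z^-1 q^(2j+1), which keeps the powers of z nonnegative. A
    new factor of the first product is absorbed by [gaussSr], one of the second by [gaussS]. *)
Lemma finite_jacobi_triple_product (a b : nat) :
  (\prod_(j < a) (1 + z * q ^+ j.*2.+1)) * (\prod_(j < b) (z + q ^+ j.*2.+1))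
  = \sum_(k < (a + b).+1) z ^+ k * q ^+ sqdist k b * gauss (q ^+ 2) (a + b) k.
Proof.
(* Multiplication by a two-term factor: f collects the terms whose power of z stays, g those whose
   power rises by one. *)
have step n (f g h : nat -> R) : f n.+1 = 0 -> h 0%N = f 0%N ->
    (forall k, (k <= n)%N -> h k.+1 = f k.+1 + g k) ->
    \sum_(k < n.+1) f k + \sum_(k < n.+1) g k = \sum_(k < n.+2) h k.
  move=> fn h0 hS; rewrite [RHS]big_ord_recl /= h0.
  under [in RHS]eq_bigr => k _ do rewrite hS ?leq_ord//.
  rewrite big_split /= addrA; congr (_ + _).
  by rewrite [in RHS]big_ord_recr /= fn addr0 big_ord_recl.
pose T b n k := z ^+ k * q ^+ sqdist k b * gauss (q ^+ 2) n k.
rewrite -[RHS]/(\sum_(k < (a + b).+1) T b (a + b)%N k).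
elim: b => [|b IHb].
  elim: a => [|a IHa].
    by rewrite !big_ord0 big_ord1 /T /sqdist /= !mulr1.
  rewrite big_ord_recr /= mulrAC {}IHa !addn0 mulrDr mulr1 mulr_suml.
  apply: (@step a (T 0%N a) (fun k => T 0%N a k * (z * q ^+ a.*2.+1)) (T 0%N a.+1)).
  - by rewrite /T gauss_small // mulr0.
  - by rewrite /T !gaussn0.
  - move=> k ka; rewrite /T gaussSr // -exprM.
    have E : q ^+ sqdist k.+1 0 * q ^+ (2 * (a - k)) = q ^+ sqdist k 0 * q ^+ a.*2.+1.
      by rewrite -!exprD; congr (_ ^+ _); rewrite /sqdist !subn0 !sub0n; nia.
    rewrite mulrDr addrC [in X in _ + X]mulrA -[_ * _ * q ^+ (_ * _)]mulrA E exprS.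
    by ring.
rewrite big_ord_recr /= mulrA {}IHb mulrDr addrC !addnS !mulr_suml.
apply: (@step (a + b)%N (fun k => T b (a + b)%N k * q ^+ b.*2.+1)
  (fun k => T b (a + b)%N k * z) (T b.+1 (a + b).+1)).
- by rewrite /T gauss_small // mulr0 mul0r.
- rewrite /T !gaussn0 !mulr1 !mul1r -exprD; congr (_ ^+ _).
  by rewrite /sqdist !subn0 !sub0n; nia.
- move=> k _; rewrite /T gaussS -exprM.
  have E : q ^+ sqdist k b * q ^+ (2 * k.+1) = q ^+ sqdist k.+1 b * q ^+ b.*2.+1.
    rewrite -!exprD; congr (_ ^+ _); rewrite /sqdist.
    (* Fixing the sign of k - b resolves the truncated subtractions. *)
    by have [[d ->]|[d ->]] : (exists d, b = k + d)%N \/ (exists d, k = b + d)%N;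
      [case: (leqP b k) => H; [right; exists (k - b)%N|left; exists (b - k)%N]; lia|nia|nia].
  have -> : sqdist k.+1 b.+1 = sqdist k b by rewrite /sqdist !subSS.
  rewrite mulrDr addrC [in X in X + _]mulrA -[_ * _ * q ^+ (_ * _)]mulrA E exprS.
  by ring.
Qed.
End FiniteJacobi.

(** * Infinite sums and limits of formal power series *)

Section XAdic.
Variable K : comNzRingType.
Implicit Types f g h : fps K.

(* [X^n] divides [f]. Locked, because [done] would otherwise evaluate coefficients. *)
Definition small (n : nat) f : bool := locked [forall i : 'I_n, coefs f i == 0].

Lemma smallP (n : nat) f :
  reflect (forall i : nat, (i < n)%N -> coefs f i = 0) (small n f).
Proof.
rewrite /small -lock.
apply: (iffP forallP) => [fn i lt_in|fn i]; last by rewrite fn.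
exact/eqP/(fn (Ordinal lt_in)).
Qed.

Lemma coefs_fps_add f g i : coefs (f + g) i = coefs f i + coefs g i.
Proof. by []. Qed.

Lemma coefs_bigsum (I : Type) (s : seq I) (P : pred I) (F : I -> fps K) N :
  coefs (\sum_(i <- s | P i) F i) N = \sum_(i <- s | P i) coefs (F i) N.
Proof. exact: (big_morph (fun f => coefs f N) (fun f g => coefs_fps_add f g N)). Qed.

Lemma coefs_subr f g i : coefs (f - g) i = coefs f i - coefs g i.
Proof. by []. Qed.

Lemma small_le m n f : (m <= n)%N -> small n f -> small m f.
Proof. by move=> mn /smallP fn; apply/smallP => i im; apply: fn; apply: leq_trans mn. Qed.

Lemma small0 n : small n 0. Proof. exact/smallP. Qed.

Lemma small0n f : small 0 f. Proof. exact/smallP. Qed.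

Lemma smallD n f g : small n f -> small n g -> small n (f + g).
Proof.
move=> /smallP fn /smallP gn; apply/smallP => i lt_in.
by rewrite coefs_fps_add fn // gn // addr0.
Qed.

Lemma smallN n f : small n f -> small n (- f).
Proof. by move/smallP => fn; apply/smallP => i lt_in; rewrite /= fn // oppr0. Qed.

Lemma smallB n f g : small n f -> small n g -> small n (f - g).
Proof. by move=> fn gn; apply/smallD/smallN. Qed.

Lemma small_sum n (I : Type) (s : seq I) (P : pred I) (F : I -> fps K) :
  (forall i, P i -> small n (F i)) -> small n (\sum_(i <- s | P i) F i).
Proof.
by move=> Fn; elim/big_ind: _ => // [|f g]; [apply: small0|apply: smallD].
Qed.

Lemma smallM m n f g : small m f -> small n g -> small (m + n) (f * g).
Proof.
move=> /smallP fm /smallP gn; apply/smallP => i imn; rewrite /= big1 // => j _.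
case: (ltnP j m) => jm; first by rewrite fm // mul0r.
by rewrite gn ?mulr0 //; move: (ltn_ord j); lia.
Qed.

Lemma smallMl n f g : small n g -> small n (f * g).
Proof. exact: (smallM (small0n f)). Qed.

Lemma smallMr n f g : small n f -> small n (f * g).
Proof. by rewrite mulrC; apply: smallMl. Qed.

Lemma smallX f n : coefs f 0%N = 0 -> small n (f ^+ n).
Proof. by move=> f0; apply/smallP => i; apply: fps_coef0X. Qed.

Lemma small_sub_sym n f g : small n (f - g) -> small n (g - f).
Proof. by move/smallN; rewrite opprB. Qed.

Lemma small_sub_trans n f g h : small n (f - g) -> small n (g - h) -> small n (f - h).
Proof. by move=> fg /(smallD fg); rewrite addrA subrK. Qed.

Lemma small_sub_mul n f f' g g' :
  small n (f - f') -> small n (g - g') -> small n (f * g - f' * g').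
Proof.
move=> ff gg; have -> : f * g - f' * g' = (f - f') * g + f' * (g - g') by ring.
by apply: smallD; [apply: smallMr|apply: smallMl].
Qed.

Lemma fps_eq_small f g : (forall n, small n (f - g)) -> f = g.
Proof.
by move=> fg; apply: fpsP => i; apply/subr0_eq; rewrite -coefs_subr (smallP _ _ (fg i.+1)).
Qed.

Lemma small_coefs n f g : small n (f - g) ->
  forall i, (i < n)%N -> coefs f i = coefs g i.
Proof. by move=> /smallP fg i /fg; rewrite coefs_subr => /subr0_eq. Qed.

Lemma coefs_small n f g : (forall i, (i < n)%N -> coefs f i = coefs g i) ->
  small n (f - g).
Proof. by move=> fg; apply/smallP => i /fg; rewrite coefs_subr => ->; rewrite subrr. Qed.

Lemma coefs0M f g : coefs (f * g) 0%N = coefs f 0%N * coefs g 0%N.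
Proof. by rewrite /= big_ord1. Qed.

Lemma coefs0X f n : coefs (f ^+ n) 0%N = coefs f 0%N ^+ n.
Proof. by elim: n => // n IH; rewrite exprS coefs0M IH -exprS. Qed.

Lemma fps_unit1B f : coefs f 0%N = 0 -> 1 - f \is a GRing.unit.
Proof. by move=> f0; apply: fps_unit1; rewrite coefs_subr f0 subr0. Qed.

Lemma fps_unit1D f : coefs f 0%N = 0 -> 1 + f \is a GRing.unit.
Proof. by move=> f0; apply: fps_unit1; rewrite coefs_fps_add f0 addr0. Qed.

Lemma small_coefs0 n f : small n.+1 f -> coefs f 0%N = 0.
Proof. by move/smallP; apply. Qed.

(** Reduces a coefficient of an infinite sum to a finite one: any duplicate-free list inside A will
    do, once it covers the support. *)
Lemma coefs_fps_sum_seq (I : choiceType) (A : set I) (F : I -> fps K)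
    (s : seq I) (N : nat) :
  uniq s -> (forall i, i \in s -> A i) ->
  (forall i, A i -> i \notin s -> coefs (F i) N = 0) ->
  coefs (fps_sum A F) N = \sum_(i <- s) coefs (F i) N.
Proof.
move=> us sA As.
rewrite /= -(@fsbig_widen _ _ _ _ [set i | i \in s] A); first 1 last.
- by move=> i /= /sA.
- by move=> i [/= Ai /negP nis]; apply: As.
exact/esym/fsbig_seq.
Qed.

Lemma fps_sum_ext (I : choiceType) (A : set I) (F G : I -> fps K) :
  (forall i, A i -> F i = G i) -> fps_sum A F = fps_sum A G.
Proof.
move=> FG; apply: fpsP => N; apply: eq_fsbigr => i.
by rewrite inE => /FG ->.
Qed.

(** * Sums over the natural numbers and their rearrangement *)

Section NatSum.
Implicit Type F G : nat -> fps K.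

(** A convenient form of X-adic convergence: the coefficient of X^N involves only the first N + 1
    terms. *)
Definition summable F := forall n, small n (F n).

Lemma coefs_fps_sum_nat F N : summable F ->
  coefs (fps_sum [set: nat] F) N = \sum_(n < N.+1) coefs (F n) N.
Proof.
move=> Fs; rewrite (@coefs_fps_sum_seq _ _ _ (iota 0 N.+1)) ?iota_uniq //.
  by rewrite -[iota _ _]/(index_iota 0 N.+1) big_mkord.
by move=> i _; rewrite mem_iota /= -leqNgt; apply/smallP/Fs.
Qed.

Lemma small_fps_sum_tail F M k : summable F ->
  (forall n, (k <= n)%N -> small M (F n)) ->
  small M (fps_sum [set: nat] F - \sum_(n < k) F n).
Proof.
move=> Fs Fk; apply: coefs_small => i iM.
rewrite coefs_fps_sum_nat // coefs_bigsum.
rewrite (big_ord_widen_cond (maxn i.+1 k) predT (fun n => coefs (F n) i)) ?leq_maxl//.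
rewrite [RHS](big_ord_widen_cond (maxn i.+1 k) predT (fun n => coefs (F n) i)) ?leq_maxr//.
rewrite big_mkcond [RHS]big_mkcond; apply: eq_bigr => n _ /=.
by case: ltnP => ni; case: ltnP => nk //; [rewrite (smallP _ _ (Fk n _))|rewrite (smallP _ _ (Fs n))].
Qed.

Lemma small_fps_sum F M : summable F ->
  small M (fps_sum [set: nat] F - \sum_(n < M) F n).
Proof.
by move=> Fs; apply: small_fps_sum_tail => // n Mn; apply: small_le (Fs n).
Qed.

Lemma fps_sum_nat_unique F f : summable F ->
  (forall M, small M (f - \sum_(n < M) F n)) -> fps_sum [set: nat] F = f.
Proof.
move=> Fs fF; apply: fps_eq_small => M.
exact: small_sub_trans (small_fps_sum _ Fs) (small_sub_sym (fF M)).
Qed.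

Lemma small_fps_sum_nat F M : summable F -> (forall n, small M (F n)) ->
  small M (fps_sum [set: nat] F).
Proof.
move=> Fs FM; have := @small_fps_sum_tail F M 0 Fs.
by rewrite big_ord0 subr0; apply.
Qed.

Lemma fps_sumD F G : summable F -> summable G ->
  fps_sum [set: nat] (fun n => F n + G n)
  = fps_sum [set: nat] F + fps_sum [set: nat] G.
Proof.
move=> Fs Gs; apply: fps_sum_nat_unique => [n|M]; first exact: smallD.
rewrite big_split /= opprD addrACA.
by apply: smallD; apply: small_fps_sum.
Qed.

Lemma fps_sumMl f F : summable F ->
  fps_sum [set: nat] (fun n => f * F n) = f * fps_sum [set: nat] F.
Proof.
move=> Fs; apply: fps_sum_nat_unique => [n|M]; first exact: smallMl.
by rewrite -mulr_sumr -mulrBr; apply/smallMl/small_fps_sum.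
Qed.

Lemma fps_sumN F : summable F ->
  fps_sum [set: nat] (fun n => - F n) = - fps_sum [set: nat] F.
Proof.
move=> Fs; rewrite -mulN1r -fps_sumMl //.
by apply: fps_sum_ext => n _; rewrite mulN1r.
Qed.

Lemma fps_sumB F G : summable F -> summable G ->
  fps_sum [set: nat] (fun n => F n - G n)
  = fps_sum [set: nat] F - fps_sum [set: nat] G.
Proof.
by move=> Fs Gs; rewrite fps_sumD ?fps_sumN // => n; apply: smallN.
Qed.

Lemma fps_sum_recl F : summable F ->
  fps_sum [set: nat] F = F 0%N + fps_sum [set: nat] (fun n => F n.+1).
Proof.
move=> Fs; apply: fps_sum_nat_unique => // M.
have Ss : summable (fun n => F n.+1) by move=> n; apply: small_le (Fs n.+1).
case: M => [|M]; first exact: small0n.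
rewrite big_ord_recl opprD addrACA subrr add0r.
by apply: small_fps_sum_tail => // n Mn; apply: small_le (Fs n.+1).
Qed.

(** As [G m r] has order at least m + r, both sides are congruent modulo X^M to the sum over the
    triangle m + r < M. *)
Lemma fps_sum_antidiag (G : nat -> nat -> fps K) :
  (forall m r, small (m + r) (G m r)) ->
  fps_sum [set: nat] (fun n => \sum_(m < n.+1) G m (n - m)%N)
  = fps_sum [set: nat] (fun r => fps_sum [set: nat] (fun m => G m r)).
Proof.
move=> Gs.
have Gr r : summable (G^~ r) by move=> m; apply: small_le (Gs m r); lia.
apply: fps_sum_nat_unique => [n|M].
  apply: small_sum => m _; apply: small_le (Gs _ _).
  by move: (ltn_ord m); lia.
apply: small_sub_trans (small_fps_sum _ _) _.
  by move=> r; apply: small_fps_sum_nat => // m; apply: small_le (Gs m r); lia.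
rewrite sum_antidiag -sumrB; apply: small_sum => r _.
apply: small_fps_sum_tail => // m mr; apply: small_le (Gs m r).
by move: (ltn_ord r); lia.
Qed.

(** The variant without the column r = 0, for series in which the zeroth power of zeta is already
    counted elsewhere. *)
Lemma fps_sum_antidiagS (G : nat -> nat -> fps K) :
  (forall m r, small (m + r) (G m r)) ->
  fps_sum [set: nat] (fun n => \sum_(m < n) G m (n - m)%N)
  = fps_sum [set: nat] (fun r => fps_sum [set: nat] (fun m => G m r.+1)).
Proof.
move=> Gs; rewrite [LHS]fps_sum_recl; last first.
  move=> n; apply: small_sum => m _; apply: small_le (Gs _ _).
  by move: (ltn_ord m); lia.
rewrite big_ord0 add0r -(@fps_sum_antidiag (fun m r => G m r.+1)); last first.
  by move=> m r; apply: small_le (Gs m r.+1); lia.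
apply: fps_sum_ext => n _; apply: eq_bigr => m _.
by rewrite subSn // leq_ord.
Qed.

End NatSum.

(** * Sums over sets of pairs, sums over the integers, and limits *)

Section DoubleSum.
Variables (I : choiceType) (A : set I) (F : I -> fps K) (h : nat -> nat -> I).
Hypothesis h_inj : forall n m n' m', h n m = h n' m' -> n = n' /\ m = m'.

(** Order at least max(n, m) confines the coefficient of X^N to the square n, m <= N. *)
Lemma fps_sum_rows :
  (forall n m, A (h n m)) ->
  (forall i, A i -> exists n m, i = h n m) ->
  (forall n m, small (maxn n m) (F (h n m))) ->
  fps_sum A F
  = fps_sum [set: nat] (fun n => fps_sum [set: nat] (fun m => F (h n m))).
Proof.
move=> hA Ah Fs.
have Fr n : summable (fun m => F (h n m)).
  by move=> m; apply: small_le (Fs n m); rewrite leq_maxr.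
apply: fpsP => N; rewrite coefs_fps_sum_nat; last first.
  move=> n; apply: small_fps_sum_nat => // m.
  by apply: small_le (Fs n m); rewrite leq_maxl.
rewrite (@coefs_fps_sum_seq _ _ _
    [seq h p.1 p.2 | p <- [seq (n, m) | n <- iota 0 N.+1, m <- iota 0 N.+1]]).
- rewrite big_map big_allpairs -[iota _ _]/(index_iota 0 N.+1) big_mkord.
  apply: eq_bigr => n _; rewrite coefs_fps_sum_nat //.
  by rewrite big_mkord.
- rewrite map_inj_uniq => [|[n m] [n' m'] /h_inj[/= -> ->]//].
  by apply: allpairs_uniq; rewrite ?iota_uniq // => -[n m] [n' m'] _ _ /=.
- by move=> _ /mapP[p _ ->].
- move=> i /Ah[n [m ->]] nm; apply: (smallP _ _ (Fs n m)); rewrite ltnNge; apply: contra nm.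
  by rewrite geq_max => /andP[nN mN]; apply/mapP; exists (n, m) => //;
    apply/allpairsP; exists (n, m); rewrite !mem_iota.
Qed.

(** When row n has only [w n] entries, order at least n is enough. *)
Lemma fps_sum_finite_rows (w : nat -> nat) :
  (forall n m, (m < w n)%N -> A (h n m)) ->
  (forall i, A i -> exists n m, (m < w n)%N /\ i = h n m) ->
  (forall n m, (m < w n)%N -> small n (F (h n m))) ->
  fps_sum A F = fps_sum [set: nat] (fun n => \sum_(m < w n) F (h n m)).
Proof.
move=> hA Ah Fs.
apply: fpsP => N; rewrite coefs_fps_sum_nat; last first.
  by move=> n; apply: small_sum => m _; apply: Fs.
rewrite (@coefs_fps_sum_seq _ _ _
    [seq h p.1 p.2 | p <- [seq (n, m) | n <- iota 0 N.+1, m <- iota 0 (w n)]]).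
- rewrite big_map big_allpairs_dep -[iota _ _]/(index_iota 0 N.+1) big_mkord.
  apply: eq_bigr => n _; rewrite coefs_bigsum.
  by rewrite -(big_mkord predT (fun m => coefs (F (h n m)) N)) /index_iota subn0.
- rewrite map_inj_uniq => [|[n m] [n' m'] /h_inj[/= -> ->]//].
  by apply: allpairs_uniq_dep => [|n _|[n m] [n' m'] _ _ /= [-> ->]];
    rewrite ?iota_uniq.
- move=> _ /mapP[_ /allpairsPdep[n [m [_ mw ->]]] ->].
  by apply: hA; move: mw; rewrite mem_iota.
- move=> i /Ah[n [m [mw ->]]] nm; apply: (smallP _ _ (Fs n m mw)); rewrite ltnNge; apply: contra nm.
  move=> nN; apply/mapP; exists (n, m) => //.
  by apply/allpairsPdep; exists n, m; rewrite !mem_iota.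
Qed.

End DoubleSum.

Lemma fps_sum_int (F : int -> fps K) :
  summable (fun n : nat => F n) -> summable (fun n => F (Negz n)) ->
  fps_sum [set: int] F
  = fps_sum [set: nat] (fun n => F n%:Z)
    + fps_sum [set: nat] (fun n => F (Negz n)).
Proof.
move=> Fp Fn; apply: fpsP => N.
rewrite coefs_fps_add !coefs_fps_sum_nat //.
rewrite (@coefs_fps_sum_seq _ _ _
    (map Posz (iota 0 N.+1) ++ map Negz (iota 0 N.+1))).
- by rewrite big_cat !big_map -[iota _ _]/(index_iota 0 N.+1) !big_mkord.
- rewrite cat_uniq !map_inj_uniq ?iota_uniq => [|? ? []//|? ? []//].
  by rewrite andbT; apply/hasPn => _ /mapP[n _ ->]; apply/mapP => -[].
- by [].
- move=> [n|n] _; rewrite mem_cat negb_or => /andP[np nn].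
  + apply: (smallP _ _ (Fp n)); rewrite ltnNge; apply: contra np => nN.
    by apply/mapP; exists n; rewrite ?mem_iota.
  + apply: (smallP _ _ (Fn n)); rewrite ltnNge; apply: contra nn => nN.
    by apply/mapP; exists n; rewrite ?mem_iota.
Qed.

(** Consecutive terms agree to growing order, so each coefficient stabilises and [xget] has a value
    to pick. *)
Lemma small_fps_lim (u : nat -> fps K) :
  (forall n, small n (u n.+1 - u n)) -> forall n, small n (fps_lim u - u n).
Proof.
move=> us.
have uD n k : small n (u (n + k)%N - u n).
  elim: k => [|k IH]; first by rewrite addn0 subrr small0.
  rewrite addnS; apply: small_sub_trans IH.
  exact: small_le (leq_addr _ _) (us _).
have E N M : (N < M)%N -> coefs (u M) N = coefs (u N.+1) N.
  by move=> NM; rewrite -(subnKC NM); apply: (small_coefs (uD _ _)).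
move=> n; apply: coefs_small => i lt_in.
rewrite E //=; apply: xget_unique => [|c [M Mc]].
  by exists i.+1 => k; apply: E.
(* Any other eventual value agrees with the stable one at a common large index. *)
by rewrite -(E i (maxn M i.+1)) ?leq_maxr// Mc ?leq_maxl.
Qed.

End XAdic.

(** * Sums of central columns of the Gauss triangle *)

Section CentralColumn.
Variables (K : comNzRingType) (x : fps K).
Hypothesis x0 : coefs x 0%N = 0.

Lemma fps_unit_1BXn n : 1 - x ^+ n.+1 \is a GRing.unit.
Proof. by apply: fps_unit1B; rewrite coefs0X x0 expr0n. Qed.

Lemma qfact_small n : small n (fps_lim (qfact x) - qfact x n).
Proof.
apply: small_fps_lim => k; rewrite qfactS mulrBr mulr1 addrC addKr.
by apply/smallN/smallMl; apply: small_le (smallX _ x0).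
Qed.

Lemma small_qfactD n k : small n (qfact x (n + k) - qfact x n).
Proof.
apply: small_sub_trans (qfact_small n).
exact: small_sub_sym (small_le (leq_addr _ _) (qfact_small (n + k))).
Qed.

Lemma qfact_inf_unit : fps_lim (qfact x) \is a GRing.unit.
Proof.
apply: fps_unit1; rewrite (small_coefs (qfact_small 1)) //.
by rewrite qfactS qfact0 mul1r coefs_subr coefs0X x0 expr0n subr0.
Qed.

Lemma small_qfactV n : small n (qfactV x n - (fps_lim (qfact x))^-1).
Proof.
have u := qfact_inf_unit; have v := qfact_unit fps_unit_1BXn n.
have -> : qfactV x n - (fps_lim (qfact x))^-1
    = qfactV x n * (fps_lim (qfact x))^-1 * (fps_lim (qfact x) - qfact x n).
  rewrite mulrBr mulrVK // mulrAC; congr (_ - _).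
  by rewrite [_ * qfact x n]mulrC qfactK ?mul1r //; apply: fps_unit_1BXn.
exact/smallMl/qfact_small.
Qed.

(** s = 1 gives the series A_N; s = 2 is the intermediate series that links the two Pascal rules. *)
Definition central_column (s N : nat) : fps K :=
  fps_sum [set: nat] (fun m => x ^+ (s * m) * gauss x (m + m + N) m).

Definition false_theta (N : nat) : fps K :=
  fps_sum [set: nat] (fun n => (-1) ^+ n * x ^+ (3 * 'C(n.+1, 2) + n * N)).

Lemma central_column_summable s N :
  summable (fun m => x ^+ (s.+1 * m) * gauss x (m + m + N) m).
Proof. by move=> m; apply/smallMr/(small_le _ (smallX _ x0)); lia. Qed.

Lemma false_theta_summable N :
  summable (fun n => (-1) ^+ n * x ^+ (3 * 'C(n.+1, 2) + n * N)).
Proof.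
by move=> n; apply/smallMl/(small_le _ (smallX _ x0)); rewrite binS bin1; lia.
Qed.

(** The rule [gaussSr] termwise: the m = 0 terms cancel, and m is shifted by one. *)
Lemma central_columnB N : central_column 1 N.+1 - central_column 1 N
  = x ^+ N.+3 * central_column 2 N.+2.
Proof.
rewrite -fps_sumB; try exact: central_column_summable.
rewrite fps_sum_recl; last first.
  by move=> n; apply: smallB; apply: central_column_summable.
rewrite !gaussn0 subrr add0r -fps_sumMl; last exact: central_column_summable.
apply: fps_sum_ext => m _; rewrite [(_ + N.+1)%N]addnS gaussSr; last by lia.
rewrite mulrDr addrK !mulrA -!exprD.
by congr (_ ^+ _ * gauss _ _ _); lia.
Qed.

(** The rule [gaussS] termwise; its factor x^m turns weight 1 into weight 2. Used at N + 2 it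
    eliminates weight 2 from [central_columnB]. *)
Lemma central_columnS N : central_column 1 N.+1
  = central_column 2 N + x * central_column 1 N.+2.
Proof.
apply/eqP; rewrite addrC -subr_eq; apply/eqP.
rewrite -fps_sumB; try exact: central_column_summable.
rewrite fps_sum_recl; last first.
  by move=> n; apply: smallB; apply: central_column_summable.
rewrite !gaussn0 subrr add0r -fps_sumMl; last exact: central_column_summable.
apply: fps_sum_ext => m _; rewrite [(_ + N.+1)%N]addnS gaussS mulrDr [X in _ + X - _]mulrA -exprD.
have -> : (1 * m.+1 + m.+1 = 2 * m.+1)%N by lia.
rewrite addrK mulrA -exprS.
by congr (_ ^+ _ * gauss _ _ _); lia.
Qed.

(** The n = 0 terms cancel on the left; after the shift of n, the n-th terms on both sides carry the
    factor 1 - x^(n+1). *)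
Lemma false_theta_rec N : false_theta N.+1 - false_theta N
  = x ^+ N.+3 * (false_theta N.+3 - x * false_theta N.+4).
Proof.
have S := false_theta_summable.
rewrite -fps_sumB // fps_sum_recl; last by move=> n; apply: smallB; apply: S.
rewrite !mul0n subrr add0r -fps_sumMl // -fps_sumB //; last by move=> n; apply/smallMl/S.
rewrite -fps_sumMl; last by move=> n; apply: smallB; [|apply: smallMl]; apply: S.
apply: fps_sum_ext => n _.
have -> : (3 * 'C(n.+2, 2) + n.+1 * N.+1
  = (3 * 'C(n.+1, 2) + n * N + N + 4 * n + 4))%N.
  by rewrite [in LHS]binS bin1; lia.
have -> : (3 * 'C(n.+2, 2) + n.+1 * N
  = (3 * 'C(n.+1, 2) + n * N + N + 3 * n + 3))%N.
  by rewrite [in LHS]binS bin1; lia.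
have -> : (3 * 'C(n.+1, 2) + n * N.+3
  = (3 * 'C(n.+1, 2) + n * N + 3 * n))%N by lia.
have -> : (3 * 'C(n.+1, 2) + n * N.+4
  = (3 * 'C(n.+1, 2) + n * N + 4 * n))%N by lia.
move: (3 * 'C(_, _))%N (n * N)%N => a b.
have -> : x ^+ N.+3 = x ^+ N * x ^+ 3 by rewrite -exprD addn3.
have -> : (4 * n = 3 * n + n)%N by lia.
rewrite !exprD exprS.
by move: (x ^+ a) (x ^+ b) (x ^+ (3 * n)) (x ^+ n) (x ^+ N) ((-1) ^+ n) =>
  *; ring.
Qed.

Lemma sum_qfactV n : \sum_(m < n.+1) x ^+ m * qfactV x m = qfactV x n.
Proof.
elim: n => [|n IH]; first by rewrite big_ord1 mul1r.
by rewrite big_ord_recr /= IH (qfactVS fps_unit_1BXn n); ring.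
Qed.

(** [2m+N; m] = (x; x)_(2m+N) / ((x; x)_m (x; x)_(m+N)), and the first and last of these products
    agree up to order N, uniformly in m. *)
Lemma small_gauss_qfactV m N : small N (gauss x (m + m + N) m - qfactV x m).
Proof.
have U := fps_unit_1BXn.
have H := gauss_qfact x m (m + N).
have -> : gauss x (m + m + N) m - qfactV x m = qfactV x m * qfactV x (m + N)
   * (qfact x (N + (m + m)) - qfact x (N + m)).
  rewrite [(N + (m + m))%N]addnC -addnA -H [(N + m)%N]addnC.
  have e1 := qfactK U m; have e2 := qfactK U (m + N).
  rewrite mulrBr; congr (_ - _).
    rewrite [RHS](_ : _ = gauss x (m + (m + N)) m * (qfact x m * qfactV x m)
      * (qfact x (m + N) * qfactV x (m + N))); last by ring.
    by rewrite e1 e2 !mulr1.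
  by rewrite -mulrA [_ * qfact _ _]mulrC e2 mulr1.
apply/smallMl/(small_sub_trans (small_qfactD _ _)).
exact/small_sub_sym/small_qfactD.
Qed.

(** Both terms are 1 to order N: the column is close to the sum of x^m / (x; x)_m over m <= N, which
    is 1/(x; x)_N, and the false theta terms with n > 0 have order above N. *)
Lemma small_central_column N :
  small N (central_column 1 N.+1 * fps_lim (qfact x) - false_theta N.+1).
Proof.
have U := fps_unit_1BXn.
have HA : small N (central_column 1 N.+1 - qfactV x N).
  apply: small_le (leqnSn N) _.
  apply: small_sub_trans (small_fps_sum N.+1 (@central_column_summable 0 N.+1)) _.
  rewrite -sum_qfactV -sumrB; apply: small_sum => m _.
  by rewrite mul1n -mulrBr; apply/smallMl/small_gauss_qfactV.
have HC : small N (false_theta N.+1 - 1).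
  rewrite /false_theta fps_sum_recl; last exact: false_theta_summable.
  rewrite mulr1 addrC addKr; apply: small_fps_sum_nat => n.
    by apply: small_le (false_theta_summable N.+1 n.+1).
  by apply/smallMl/(small_le _ (smallX _ x0)); lia.
apply: small_sub_trans (small_sub_sym HC).
rewrite -(qfactK U N) [qfact x N * _]mulrC.
exact: small_sub_mul HA (qfact_small N).
Qed.

(* Both sides satisfy the recurrence [a (N+1) - a N = x^(N+3) (a (N+3) - x a (N+4))]
   and tend to 1 as N grows; the recurrence propagates any x-adic
   approximation of the limit down to all N. *)
Lemma central_columnE N :
  central_column 1 N * fps_lim (qfact x) = false_theta N.
Proof.
pose D N := central_column 1 N * fps_lim (qfact x) - false_theta N.
have DS M : D M.+1 - D M = x ^+ M.+3 * (D M.+3 - x * D M.+4).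
  have -> : D M.+1 - D M
      = (central_column 1 M.+1 - central_column 1 M) * fps_lim (qfact x)
        - (false_theta M.+1 - false_theta M) by rewrite /D; ring.
  rewrite central_columnB false_theta_rec /D (central_columnS M.+2).
  by ring.
have H k : forall M, small k (D M).
  elim: k => [|k IH] M; first exact: small0n.
  have step j : small k.+1 (D (M + j)%N - D M).
    elim: j => [|j IHj]; first by rewrite addn0 subrr small0.
    rewrite addnS; apply: small_sub_trans IHj; rewrite DS.
    (* A single factor x in the recurrence improves the order from k to k + 1. *)
    rewrite -[k.+1]add1n; apply: smallM.
      by apply: (small_le _ (smallX _ x0)).
    by apply: smallB; [|apply: smallMl].
  (* Far enough out, at M + k + 2, order k + 1 is known from the limit; [step] carries it back to
     M. *)
  have := step k.+2; move/small_sub_sym/smallD => H; have := H (D (M + k.+2)%N).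
  rewrite subrK; apply; rewrite addnS /D.
  by apply: small_le (small_central_column _); rewrite leq_addl.
by apply: fps_eq_small => n; apply: H.
Qed.
End CentralColumn.

Section OddUnimodal.

Implicit Types w : fps laurent.
Local Notation x := (q ^+ 2).
Local Notation poch n := (qpoch [:: - zeta * q; - zeta^-1 * q] x n).
Local Notation S :=
  (fps_sum [set: nat] (fun n => poch n * q ^+ (2 * n + 1))).
Local Notation Vinf := (fps_lim (qfact x))^-1.
Local Notation V := (qfactV x).
Local Notation J := (qpoch_inf [:: - zeta * q; - zeta^-1 * q] x).

(** * The Hecke-type series *)

Lemma coefs_q0 : coefs q 0%N = 0. Proof. by []. Qed.

Lemma coefs_x0 : coefs x 0%N = 0.
Proof. by rewrite coefs0X coefs_q0 expr0n. Qed.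

Lemma small_qX m n : (m <= n)%N -> small m (q ^+ n).
Proof. by move/small_le; apply; apply/smallX/coefs_q0. Qed.

Lemma zetaK : zeta * zeta^-1 = 1. Proof. exact/mulrV/zeta_unit. Qed.

Lemma zeta_expK m n : zeta ^+ (m + n) * zeta^-1 ^+ m = zeta ^+ n.
Proof. by rewrite exprD mulrAC -exprMn zetaK expr1n mul1r. Qed.

Lemma zetaV_expK m n : zeta ^+ m * zeta^-1 ^+ (m + n) = zeta^-1 ^+ n.
Proof. by rewrite exprD mulrA -exprMn zetaK expr1n mul1r. Qed.

Lemma qpoch_cons (a b : fps laurent) n :
  qpoch [:: a; b] x n = \prod_(j < n) (1 - a * x ^+ j) * \prod_(j < n) (1 - b * x ^+ j).
Proof. by rewrite /qpoch big_cons big_seq1. Qed.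

Lemma poch_factor w n : \prod_(j < n) (1 - (- w * q) * x ^+ j)
  = \prod_(j < n) (1 + w * q ^+ j.*2.+1).
Proof.
apply: eq_bigr => j _; rewrite -exprM mul2n exprS; ring.
Qed.

Lemma pochE n : poch n = \prod_(j < n) (1 + zeta * q ^+ j.*2.+1)
  * \prod_(j < n) (1 + zeta^-1 * q ^+ j.*2.+1).
Proof. by rewrite qpoch_cons !poch_factor. Qed.

Lemma qpoch_inf_qfact : qpoch_inf [:: x] x = fps_lim (qfact x).
Proof.
rewrite /qpoch_inf big_seq1; congr fps_lim; apply/funext => n.
by rewrite /qpoch big_seq1; apply: eq_bigr => j _; rewrite -exprS.
Qed.

(** The w^r part of P_n q^(2n+1) for n = m + r, where w is zeta or its inverse. *)
Definition jacobi_term w m r : fps laurent :=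
  w ^+ r * q ^+ (r ^ 2) * gauss x (m + m + (r + r)) m * q ^+ (2 * (m + r) + 1).

(** The finite triple product with n factors on each side, divided by zeta^n. Indices k >= n give
    the first sum, by symmetry of the Gauss binomial, and k < n the second; the middle term k = n is
    only in the first. *)
Lemma poch_jacobi n : poch n * q ^+ (2 * n + 1)
  = \sum_(m < n.+1) jacobi_term zeta m (n - m)
    + \sum_(m < n) jacobi_term zeta^-1 m (n - m).
Proof.
have -> : poch n = zeta^-1 ^+ n *
    \sum_(k < (n + n).+1) zeta ^+ k * q ^+ sqdist k n * gauss x (n + n) k.
  rewrite -finite_jacobi_triple_product pochE mulrCA; congr (_ * _).
  rewrite -[X in _ ^+ X * _](card_ord n) -prodr_const -big_split /=.
  by apply: eq_bigr => j _; rewrite mulrDr [_ * zeta]mulrC zetaK.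
rewrite -addnS big_split_ord /= mulrDr mulrDl addrC; congr (_ + _).
  rewrite mulr_sumr mulr_suml (reindex_inj rev_ord_inj).
  apply: eq_bigr => m _ /=; have mn := leq_ord m; rewrite subSS /jacobi_term.
  rewrite (_ : sqdist (n + (n - m)) n = (n - m) ^ 2)%N; last first.
    by rewrite /sqdist; nia.
  rewrite !mulrA [zeta^-1 ^+ n * _]mulrC zeta_expK.
  have -> : (m + m + (n - m + (n - m)) = m + (n + (n - m)))%N by lia.
  rewrite gauss_sym; congr (_ * gauss _ _ _ * _ ^+ _); lia.
rewrite mulr_sumr mulr_suml.
apply: eq_bigr => m _ /=; have mn := ltn_ord m; rewrite /jacobi_term.
rewrite (_ : sqdist m n = (n - m) ^ 2)%N; last first.
  by rewrite /sqdist; nia.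
rewrite -{1}(subnKC (ltnW mn)) !mulrA [zeta^-1 ^+ _ * _]mulrC zetaV_expK.
congr (_ * gauss _ _ _ * _ ^+ _); lia.
Qed.

(* The coefficient of [zeta^r] (r >= 0) in the Hecke-type series is [sum_n hecke n r]. *)
Definition hecke n r : fps laurent :=
  (-1) ^+ n * q ^+ (3 * n ^ 2 + 3 * n + 4 * n * r + r ^ 2 + 2 * r).

Lemma small_hecke w n r : small (n + r) (w * hecke n r).
Proof. by apply/smallMl/smallMl/small_qX; nia. Qed.

Local Notation hecke_sum := (
  fps_sum [set: nat] (fun r => fps_sum [set: nat] (fun n => zeta ^+ r * hecke n r))
  + fps_sum [set: nat]
      (fun r => fps_sum [set: nat] (fun n => zeta^-1 ^+ r.+1 * hecke n r.+1))).

Lemma summable_hecke w r : summable (fun n => w * hecke n r).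
Proof. by move=> n; apply: small_le (small_hecke w n r); lia. Qed.

Lemma small_hecke_row w r : small r (fps_sum [set: nat] (fun n => w * hecke n r)).
Proof.
apply: small_fps_sum_nat => [|n]; first exact: summable_hecke.
by apply: small_le (small_hecke w n r); lia.
Qed.

Lemma small_jacobi_term w m r : small (m + r) (jacobi_term w m r).
Proof. by apply/smallMl/small_qX; lia. Qed.

(** The sum over m is a multiple of A_(2r) in x = q^2, which [central_columnE] replaces by a false
    theta series over (x; x)_oo. *)
Lemma jacobi_term_sum w r :
  fps_sum [set: nat] (fun m => jacobi_term w m r)
  = q * Vinf * fps_sum [set: nat] (fun n => w ^+ r * hecke n r).
Proof.
have cc := central_columnE coefs_x0 (r + r).
have -> : fps_sum [set: nat] (fun m => jacobi_term w m r)
    = w ^+ r * q ^+ (r ^ 2 + 2 * r + 1) * central_column x 1 (r + r).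
  rewrite /central_column -fps_sumMl; last exact: (central_column_summable coefs_x0).
  apply: fps_sum_ext => m _; rewrite /jacobi_term mul1n -exprM.
  have -> : (2 * (m + r) + 1 = 2 * m + (2 * r + 1))%N by lia.
  rewrite [in LHS]exprD -[(r ^ 2 + _ + _)%N]addnA [in RHS]exprD; ring.
have -> : fps_sum [set: nat] (fun n => w ^+ r * hecke n r)
    = w ^+ r * q ^+ (r ^ 2 + 2 * r) * false_theta x (r + r).
  rewrite /false_theta -fps_sumMl; last exact: (false_theta_summable coefs_x0).
  apply: fps_sum_ext => n _; rewrite /hecke -exprM.
  have -> : (3 * n ^ 2 + 3 * n + 4 * n * r + r ^ 2 + 2 * r
    = (r ^ 2 + 2 * r) + 2 * (3 * 'C(n.+1, 2) + n * (r + r)))%N.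
    suff : ('C(n.+1, 2) * 2 = n.+1 * n)%N by nia.
    by rewrite bin2 /= muln2 -[RHS]odd_double_half oddM /= andNb add0n.
  by rewrite [in LHS]exprD; ring.
rewrite -cc addn1 exprS.
have e := mulVr (qfact_inf_unit coefs_x0).
rewrite [RHS](_ : _ = (Vinf * fps_lim (qfact x))
  * (w ^+ r * (q * q ^+ (r ^ 2 + 2 * r)) * central_column x 1 (r + r))).
  by rewrite e mul1r.
ring.
Qed.

Lemma generating_function_hecke : S = q * Vinf * hecke_sum.
Proof.
rewrite (fps_sum_ext (fun n _ => poch_jacobi n)).
rewrite fps_sumD; first last.
- move=> n; apply: small_sum => m _; apply: small_le (small_jacobi_term _ _ _); lia.
- move=> n; apply: small_sum => m _; apply: small_le (small_jacobi_term _ _ _); lia.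
rewrite fps_sum_antidiag ?fps_sum_antidiagS; try exact: small_jacobi_term.
rewrite mulrDr; congr (_ + _); rewrite -fps_sumMl.
- by apply: fps_sum_ext => r _; apply: jacobi_term_sum.
- by move=> r; apply: small_hecke_row.
- by apply: fps_sum_ext => r _; apply: jacobi_term_sum.
- by move=> r; apply: small_le (small_hecke_row _ _).
Qed.

Lemma exprz_Negz (R : unitRingType) (a : R) n : a ^ Negz n = a^-1 ^+ n.+1.
Proof. by rewrite exprVn. Qed.

(** Under (n, r) -> (-1 - n, -r) the exponent is invariant and the sign flips. Hence the subtracted
    quadrant supplies exactly the negative powers of zeta, with the right sign. *)
Lemma hecke_identity :
  S = q / qpoch_inf [:: x] x *
    (let F := fun p : int * int => let: (n, r) := p in
       (-1) ^ n * zeta ^ r *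
         q ^ (3 * n ^+ 2 + 3 * n + 4 * n * r + r ^+ 2 + 2 * r) in
     fps_sum [set p : int * int | 0 <= p.1 /\ 0 <= p.2] F
     - fps_sum [set p : int * int | p.1 < 0 /\ p.2 < 0] F).
Proof.
rewrite generating_function_hecke qpoch_inf_qfact; congr (_ * _).
have Fpos (n r : nat) : (-1) ^ n%:Z * zeta ^ r%:Z *
    q ^ (3 * n%:Z ^+ 2 + 3 * n + 4 * n * r + r%:Z ^+ 2 + 2 * r)
    = zeta ^+ r * hecke n r.
  have -> : 3 * n%:Z ^+ 2 + 3 * n + 4 * n * r + r%:Z ^+ 2 + 2 * r
    = (3 * n ^ 2 + 3 * n + 4 * n * r + r ^ 2 + 2 * r)%N by lia.
  by rewrite /hecke -!exprnP; ring.
have Fneg (n r : nat) : (-1) ^ Negz n * zeta ^ Negz r *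
    q ^ (3 * Negz n ^+ 2 + 3 * Negz n + 4 * Negz n * Negz r + Negz r ^+ 2 + 2 * Negz r)
    = - (zeta^-1 ^+ r.+1 * hecke n r.+1).
  have -> : 3 * Negz n ^+ 2 + 3 * Negz n + 4 * Negz n * Negz r + Negz r ^+ 2
      + 2 * Negz r
    = (3 * n ^ 2 + 3 * n + 4 * n * r.+1 + r.+1 ^ 2 + 2 * r.+1)%N by lia.
  by rewrite !exprz_Negz invrN1 /hecke [(-1) ^+ n.+1]exprS -!exprnP; ring.
congr (_ + _).
- rewrite (@fps_sum_rows _ _ _ _ (fun r n : nat => (n%:Z, r%:Z))) //.
  + apply: fps_sum_ext => r _; apply: fps_sum_ext => n _ /=.
    by rewrite Fpos.
  + by move=> ? ? ? ? [-> ->].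
  + by move=> [[n|n] [r|r]] [//= _ _]; exists r, n.
  + move=> r n; rewrite Fpos; apply: small_le (small_hecke _ _ _); lia.
- rewrite (@fps_sum_rows _ _ _ _ (fun r n : nat => (Negz n, Negz r))) //.
  + rewrite -fps_sumN.
      apply: fps_sum_ext => r _; rewrite -fps_sumN; last first.
        by move=> n; rewrite Fneg; apply: smallN; apply: summable_hecke.
      by apply: fps_sum_ext => n _; rewrite Fneg opprK.
    move=> r; apply: small_fps_sum_nat => n; rewrite Fneg; apply: smallN.
      exact: summable_hecke.
    by apply: small_le (small_hecke _ _ _); lia.
  + by move=> ? ? ? ? [-> ->].
  + by move=> [[n|n] [r|r]] [//= _ _]; exists r, n.
  + move=> r n; rewrite Fneg; apply/smallN/(small_le _ (small_hecke _ _ _)); lia.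
Qed.

(** * The Lerch-type sums *)

Lemma inv1Dzq_pos n : inv1Dzq (n.*2.+1)%:Z = (1 + zeta * q ^+ n.*2.+1)^-1.
Proof. by []. Qed.

Lemma inv1Dzq_neg n : inv1Dzq (- (n.*2.+1)%:Z)
  = zeta^-1 * q ^+ n.*2.+1 * (1 + zeta^-1 * q ^+ n.*2.+1)^-1.
Proof. by rewrite /inv1Dzq oppr_ge0 opprK. Qed.

(** A finite geometric sum in - a q^(2n+1). As a b = 1, b^n a^i = b^(n-i), and (n+1)^2 + (2n+1) i is
    one more than the Hecke exponent at (i, n - i); the bound on m keeps n - i from truncating. It
    is applied with m = n and with m = n + 1. *)
Lemma geometric_hecke a b n m : a * b = 1 -> (m <= n.+1)%N ->
  b ^+ n * q ^+ (n.+1 ^ 2) * (1 - (- (a * q ^+ n.*2.+1)) ^+ m)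
    * (1 + a * q ^+ n.*2.+1)^-1
  = q * \sum_(i < m) b ^+ (n - i) * hecke i (n - i).
Proof.
move=> ab mn; set y := a * _.
have -> : 1 - (- y) ^+ m = (\sum_(i < m) (- y) ^+ i) * (1 + y).
  by rewrite -opprB subrX1 -mulNr opprB opprK mulrC.
rewrite -!mulrA mulrV ?mulr1; last first.
  by apply/fps_unit1D/(@small_coefs0 _ 0)/smallMl/small_qX.
rewrite mulrA !mulr_sumr; apply: eq_bigr => i _.
have ni : (i <= n)%N by move: (ltn_ord i) mn; lia.
rewrite /y -[- _]mulN1r !exprMn /hecke -exprM -{1}(subnK ni) exprD.
have -> : b ^+ (n - i) * b ^+ i * q ^+ (n.+1 ^ 2) *
    ((-1) ^+ i * (a ^+ i * q ^+ (n.*2.+1 * i)))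
  = (a * b) ^+ i * (b ^+ (n - i) * (-1) ^+ i * (q ^+ (n.+1 ^ 2) * q ^+ (n.*2.+1 * i))).
  by rewrite exprMn; ring.
rewrite ab expr1n mul1r -exprD.
have -> : (n.+1 ^ 2 + n.*2.+1 * i = (3 * i ^ 2 + 3 * i + 4 * i * (n - i) +
     (n - i) ^ 2 + 2 * (n - i)).+1)%N.
  by rewrite -{1 2}(subnK ni); move: (n - i)%N => d; nia.
by rewrite exprS; ring.
Qed.

(** For n >= 0 and y = zeta q^(2n+1), multiplying zeta^(-n) q^((n+1)^2) by (-y)^n gives (-1)^n
    q^(3n^2+3n+1), so the two summands combine into a multiple of (1 - (-y)^n)/(1 + y). At -1 - n
    the prescribed expansion gives the same shape with zeta inverted and exponent n + 1. *)
Lemma lerch_identity :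
  S = - ((qpoch_inf [:: x] x)^-1 *
         fps_sum [set: int] (fun n =>
           (-1) ^ n * q ^ (3 * n ^+ 2 + 3 * n + 1) * inv1Dzq (2 * n + 1)))
      + (qpoch_inf [:: x] x)^-1 *
         fps_sum [set: int] (fun n =>
           zeta ^ (- n) * q ^ (n ^+ 2 + 2 * n + 1) * inv1Dzq (2 * n + 1)).
Proof.
rewrite qpoch_inf_qfact generating_function_hecke [RHS]addrC -mulrBr mulrAC mulrC.
congr (_ * _).
have posE n : 2 * n%:Z + 1 = (n.*2.+1)%:Z by lia.
have negE n : 2 * Negz n + 1 = - (n.*2.+1)%:Z by lia.
have zV : zeta^-1 * zeta = 1 by rewrite mulrC zetaK.
pose u n := (1 + zeta * q ^+ n.*2.+1)^-1.
pose v n := (1 + zeta^-1 * q ^+ n.*2.+1)^-1.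
have F1p (n : nat) : (-1) ^ n%:Z * q ^ (3 * n%:Z ^+ 2 + 3 * n%:Z + 1) * inv1Dzq (2 * n%:Z + 1)
    = (-1) ^+ n * q ^+ (3 * n ^ 2 + 3 * n + 1) * u n.
  rewrite posE inv1Dzq_pos.
  by have -> : 3 * n%:Z ^+ 2 + 3 * n%:Z + 1 = (3 * n ^ 2 + 3 * n + 1)%N by lia.
have F2p (n : nat) : zeta ^ (- n%:Z) * q ^ (n%:Z ^+ 2 + 2 * n%:Z + 1) * inv1Dzq (2 * n%:Z + 1)
    = zeta^-1 ^+ n * q ^+ (n.+1 ^ 2) * u n.
  rewrite posE inv1Dzq_pos -exprz_inv -exprnP.
  by have -> : n%:Z ^+ 2 + 2 * n%:Z + 1 = (n.+1 ^ 2)%N by lia.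
have F1n (n : nat) : (-1) ^ Negz n * q ^ (3 * Negz n ^+ 2 + 3 * Negz n + 1)
      * inv1Dzq (2 * Negz n + 1)
    = (-1) ^+ n.+1 * q ^+ (3 * n ^ 2 + 3 * n + 1) * (zeta^-1 * q ^+ n.*2.+1 * v n).
  rewrite negE inv1Dzq_neg exprz_Negz invrN1.
  by have -> : 3 * Negz n ^+ 2 + 3 * Negz n + 1 = (3 * n ^ 2 + 3 * n + 1)%N by lia.
have F2n (n : nat) : zeta ^ (- Negz n) * q ^ (Negz n ^+ 2 + 2 * Negz n + 1)
      * inv1Dzq (2 * Negz n + 1)
    = zeta ^+ n.+1 * q ^+ (n ^ 2) * (zeta^-1 * q ^+ n.*2.+1 * v n).
  rewrite negE inv1Dzq_neg NegzE opprK -exprnP.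
  by have -> : (- n.+1%:Z) ^+ 2 + 2 * (- n.+1%:Z) + 1 = (n ^ 2)%N by lia.
have S1p : summable (fun n : nat => (-1) ^ n%:Z * q ^ (3 * n%:Z ^+ 2 + 3 * n%:Z + 1)
    * inv1Dzq (2 * n%:Z + 1)).
  by move=> n; rewrite F1p; apply/smallMr/smallMl/small_qX; lia.
have S1n : summable (fun n : nat => (-1) ^ Negz n * q ^ (3 * Negz n ^+ 2 + 3 * Negz n + 1)
    * inv1Dzq (2 * Negz n + 1)).
  by move=> n; rewrite F1n; apply/smallMr/smallMl/small_qX; lia.
have S2p : summable (fun n : nat => zeta ^ (- n%:Z) * q ^ (n%:Z ^+ 2 + 2 * n%:Z + 1)
    * inv1Dzq (2 * n%:Z + 1)).
  by move=> n; rewrite F2p; apply/smallMr/smallMl/small_qX; lia.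
have S2n : summable (fun n : nat => zeta ^ (- Negz n) * q ^ (Negz n ^+ 2 + 2 * Negz n + 1)
    * inv1Dzq (2 * Negz n + 1)).
  by move=> n; rewrite F2n; apply/smallMl/smallMr/smallMl/small_qX; lia.
rewrite (fps_sum_int S2p S2n) (fps_sum_int S1p S1n) opprD addrACA.
rewrite -(fps_sumB S2p S1p) -(fps_sumB S2n S1n) {S1p S1n S2p S2n}.
(* Nonnegative indices produce the negative powers of zeta, negative indices the others; hence the
   swap. *)
rewrite mulrDr [LHS]addrC; congr (_ + _).
- transitivity (fps_sum [set: nat] (fun n =>
      q * \sum_(i < n) zeta^-1 ^+ (n - i) * hecke i (n - i))); last first.
    apply: fps_sum_ext => n _; rewrite F1p F2p -(geometric_hecke zetaK) //.
    rewrite -/(u n) -mulrBl; congr (_ * _); rewrite mulrBr mulr1; congr (_ - _).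
    rewrite -[- _]mulN1r !exprMn -exprM.
    have -> : zeta^-1 ^+ n * q ^+ (n.+1 ^ 2) *
        ((-1) ^+ n * (zeta ^+ n * q ^+ (n.*2.+1 * n)))
      = (zeta^-1 * zeta) ^+ n * ((-1) ^+ n * (q ^+ (n.+1 ^ 2) * q ^+ (n.*2.+1 * n))).
      by rewrite exprMn; ring.
    by rewrite zV expr1n mul1r -exprD; congr (_ * _ ^+ _); nia.
  rewrite fps_sumMl; last first.
    move=> n; apply: small_sum => i _; apply: small_le (small_hecke _ _ _).
    by move: (ltn_ord i); lia.
  congr (_ * _).
  by rewrite -(@fps_sum_antidiagS _ (fun m r => zeta^-1 ^+ r * hecke m r)) // => m r;
    apply: small_hecke.
- transitivity (fps_sum [set: nat] (fun n =>
      q * \sum_(i < n.+1) zeta ^+ (n - i) * hecke i (n - i))); last first.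
    apply: fps_sum_ext => n _; rewrite F1n F2n -(geometric_hecke zV) //.
    rewrite -/(v n) !mulrA -mulrBl; congr (_ * _); rewrite mulrBr mulr1; congr (_ - _).
      have -> : zeta ^+ n.+1 * q ^+ (n ^ 2) * zeta^-1 * q ^+ n.*2.+1
        = (zeta * zeta^-1) * zeta ^+ n * (q ^+ (n ^ 2) * q ^+ n.*2.+1).
        by rewrite exprS; ring.
      by rewrite zetaK mul1r -exprD; congr (_ * _ ^+ _); nia.
    rewrite -[- (_ * _)]mulN1r !exprMn -exprM.
    have -> : zeta ^+ n * q ^+ (n.+1 ^ 2) *
        ((-1) ^+ n.+1 * (zeta^-1 ^+ n.+1 * q ^+ (n.*2.+1 * n.+1)))
      = (zeta * zeta^-1) ^+ n *
        ((-1) ^+ n.+1 * zeta^-1 * (q ^+ (n.+1 ^ 2) * q ^+ (n.*2.+1 * n.+1))).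
      rewrite [(zeta * _) ^+ n]exprMn [zeta^-1 ^+ n.+1]exprS.
      move: (q ^+ (n.+1 ^ 2)) (q ^+ (n.*2.+1 * n.+1)) ((-1) ^+ n.+1) => a b c.
      by ring.
    have -> : q ^+ (n.+1 ^ 2) * q ^+ (n.*2.+1 * n.+1)
        = q ^+ (3 * n ^ 2 + 3 * n + 1) * q ^+ n.*2.+1.
      by rewrite -!exprD; congr (_ ^+ _); nia.
    rewrite zetaK expr1n mul1r.
    by move: (q ^+ (_ + 1)) (q ^+ n.*2.+1) ((-1) ^+ n.+1) => a b c; ring.
  rewrite fps_sumMl; last first.
    move=> n; apply: small_sum => i _; apply: small_le (small_hecke _ _ _).
    by move: (ltn_ord i); lia.
  congr (_ * _).
  by rewrite -(@fps_sum_antidiag _ (fun m r => zeta ^+ r * hecke m r)) // => m r;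
    apply: small_hecke.
Qed.

(** * The indefinite theta series *)

Lemma small_qpoch1 (a : fps laurent) n :
  small n (fps_lim (qpoch [:: a] x) - qpoch [:: a] x n).
Proof.
apply: small_fps_lim => k; rewrite /qpoch !big_seq1 big_ord_recr /=.
rewrite mulrBr mulr1 addrC addKr mulrA.
by apply/smallN/smallMl/smallX/coefs_x0.
Qed.

Lemma small_poch n : small n (J - poch n).
Proof.
rewrite qpoch_cons /qpoch_inf big_cons big_seq1.
have E a : \prod_(j < n) (1 - a * x ^+ j) = qpoch [:: a] x n.
  by rewrite /qpoch big_seq1.
by rewrite !E; apply: small_sub_mul; apply: small_qpoch1.
Qed.

(** The product of the alpha-side with the limit of the conjugate side, without the common factor J
    / (x; x)_oo^2. The inverses undo the two factors that made the conjugate sum telescope. *)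
Definition bailey_term r : fps laurent :=
  (1 - x ^+ r.*2.+1) * bailey_alpha x r * x ^+ r
  * ((1 + zeta * q ^+ r.*2.+1)^-1 * (1 + zeta^-1 * q ^+ r.*2.+1)^-1).

Lemma unit_1Dwq w n : 1 + w * q ^+ n.+1 \is a GRing.unit.
Proof. by apply/fps_unit1D/(@small_coefs0 _ 0)/smallMl/small_qX. Qed.

(** A truncated Bailey lemma: each summand is multiplied by 1 in the form of [bailey_pair1], the
    finite sums are exchanged, and [conjugate_bailey_pair] with y = - zeta q and z = - zeta^-1 q
    evaluates the inner one. *)
Lemma poch_bailey M :
  \sum_(l < M.+1) poch l * x ^+ l
  = \sum_(r < M.+1) bailey_term r * (poch M.+1 * V (M - r) * V (M + r).+1).
Proof.
have U := fps_unit_1BXn coefs_x0.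
pose G i r := (1 - x ^+ r.*2.+1) * bailey_alpha x r
  * (poch (r + i) * x ^+ (r + i) * V i * V (r + r + i).+1).
have -> : \sum_(l < M.+1) poch l * x ^+ l
    = \sum_(l < M.+1) \sum_(i < l.+1) G i (l - i)%N.
  apply: eq_bigr => l _.
  rewrite -[LHS]mulr1 -(bailey_pair1 U l) mulr_sumr.
  rewrite [RHS](reindex_inj rev_ord_inj); apply: eq_bigr => r _ /=.
  have rl := leq_ord r.
  rewrite subSS [(l - (l - r))%N](subKn rl) /G.
  have -> : (r + r + (l - r) = l + r)%N by lia.
  rewrite [(r + (l - r))%N](subnKC rl).
  ring.
rewrite sum_antidiag; apply: eq_bigr => r _; have rM := leq_ord r.
rewrite subSn // /G -mulr_sumr.
have yz : (- zeta * q) * (- zeta^-1 * q) = x.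
  by transitivity (zeta * zeta^-1 * x); [ring|rewrite zetaK mul1r].
have PE n : poch n
    = \prod_(j < n) ((1 - - zeta * q * x ^+ j) * (1 - - zeta^-1 * q * x ^+ j)).
  by rewrite qpoch_cons big_split.
have := conjugate_bailey_pair U r (M - r) yz; rewrite /= -!PE.
under eq_bigr => i _ do rewrite -PE.
have u w : 1 - - w * q * x ^+ r = 1 + w * q ^+ r.*2.+1.
  by rewrite -exprM mul2n exprS; ring.
rewrite !u (subnKC rM); have -> : (r + r + (M - r) = M + r)%N by lia.
set s := \sum_(i < _) _ => E.
have -> : s = s * ((1 + zeta * q ^+ r.*2.+1) * (1 + zeta^-1 * q ^+ r.*2.+1))
  * ((1 + zeta * q ^+ r.*2.+1)^-1 * (1 + zeta^-1 * q ^+ r.*2.+1)^-1).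
  by rewrite -mulrA mulrACA !mulrV ?mulr1 ?unit_1Dwq.
by rewrite E /bailey_term; ring.
Qed.

Lemma summable_bailey_term : summable bailey_term.
Proof. by move=> r; apply/smallMr/smallMl/smallX/coefs_x0. Qed.

Lemma generating_function_bailey :
  S = J * (Vinf * Vinf) * fps_sum [set: nat] (fun r => q * bailey_term r).
Proof.
have Ps : summable (fun n => poch n * x ^+ n).
  by move=> n; apply/smallMl/smallX/coefs_x0.
rewrite fps_sumMl; last exact: summable_bailey_term.
rewrite mulrCA.
rewrite (_ : S = q * fps_sum [set: nat] (fun n => poch n * x ^+ n)); last first.
  rewrite -fps_sumMl //; apply: fps_sum_ext => n _.
  by rewrite addn1 (exprS q (2 * n)) exprM mulrCA.
apply: (congr1 (fun f => q * f)).
apply: (fps_sum_nat_unique Ps).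
move=> M.
have -> : \sum_(n < M) poch n * x ^+ n
    = \sum_(n < M.+1) poch n * x ^+ n - poch M * x ^+ M.
  by rewrite big_ord_recr addrK.
rewrite opprB addrCA; apply: smallD; first exact: Ps.
rewrite poch_bailey.
apply: (@small_sub_trans _ _ _ (J * (Vinf * Vinf) * \sum_(r < M.+1) bailey_term r)).
  rewrite -mulrBr; apply/smallMl/small_fps_sum_tail => [|n Mn].
    exact: summable_bailey_term.
  by apply: small_le (summable_bailey_term n); lia.
rewrite mulr_sumr -sumrB; apply: small_sum => r _; have rM := leq_ord r.
rewrite [_ * bailey_term r]mulrC -mulrBr.
(* Replacing the finite products by their limits costs an error of order M - r only; the missing r
   comes from [bailey_term r]. *)
apply: (@small_le _ M (r + (M - r))); first by rewrite (subnKC rM).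
apply: smallM; first exact: summable_bailey_term.
rewrite -!mulrA; apply: small_sub_mul.
  by apply: small_le (small_poch _); lia.
apply: small_sub_mul; apply/small_sub_sym.
  exact: (small_qfactV coefs_x0).
by apply: small_le (small_qfactV coefs_x0 _); lia.
Qed.

(* The exponent Q(r', s') at (r', s') = (i, 2r - i) and at (-1 - (2r - i), -1 - i). *)
Definition Qnat r i : nat := (r ^ 2 + 5 * r + 1 + 6 * i * r) - (3 * i ^ 2 + i).

Lemma bin2_dbl r : (2 * 'C(r.+1, 2) = r.+1 * r)%N.
Proof. by rewrite mul2n bin2 -[RHS]odd_double_half oddM /= andNb. Qed.

(** In [bailey_alphaS] the factor x^(4r+4) = q^(8r+8) moves (r, i) to (r + 1, i + 1), as Q grows by
    8r + 8. The two new powers are the end terms: i = 0 comes from x^(2r+2), i = 2r + 2 from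
    x^(r+1). *)
Lemma bailey_alphaE r : q * x ^+ r * bailey_alpha x r
  = \sum_(i < r.*2.+1) (-1) ^+ (i + r) * q ^+ Qnat r i.
Proof.
have U := fps_unit_1BXn coefs_x0.
elim: r => [|r IH].
  by rewrite big_ord1 bailey_alpha0 !mulr1 mul1r.
rewrite doubleS big_ord_recl big_ord_recr /= bailey_alphaS //.
rewrite mulrDr.
have -> : q * x ^+ r.+1 * (x ^+ (4 * r + 3) * bailey_alpha x r)
    = x ^+ (4 * r + 4) * (q * x ^+ r * bailey_alpha x r).
  rewrite (exprD x (4 * r) 3) (exprD x (4 * r) 4) [x ^+ r.+1]exprS.
  ring.
rewrite IH mulr_sumr.
have -> : \sum_(i < r.*2.+1) (-1) ^+ (bump 0 i + r.+1) * q ^+ Qnat r.+1 (bump 0 i)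
    = \sum_(i < r.*2.+1) x ^+ (4 * r + 4) * ((-1) ^+ (i + r) * q ^+ Qnat r i).
  apply: eq_bigr => i _; rewrite /bump /=.
  have -> : (1 + i + r.+1 = (i + r).+2)%N by lia.
  rewrite (exprS (-1) (i + r).+1) (exprS (-1) (i + r)) !mulN1r opprK.
  rewrite mulrCA -exprM -exprD; congr (_ * _ ^+ _).
  move: (nat_of_ord i) (leq_ord i) => k kr.
  have : (k * k <= k * r.*2)%N by rewrite leq_mul2l kr orbT.
  rewrite /Qnat; nia.
have -> : q * x ^+ r.+1 * (sgnq x r.+1 * (x ^+ r.+1 + x ^+ r.+1.*2))
  = (-1) ^+ (0 + r.+1) * q ^+ Qnat r.+1 0
    + (-1) ^+ (r.*2.+2 + r.+1) * q ^+ Qnat r.+1 r.*2.+2.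
  have Q0 : Qnat r.+1 0 = (1 + 2 * r.+1 + 2 * 'C(r.+1, 2) + 2 * r.+1.*2)%N.
    by move: (bin2_dbl r); rewrite /Qnat; nia.
  have Q1 : Qnat r.+1 r.*2.+2 = (1 + 2 * r.+1 + 2 * 'C(r.+1, 2) + 2 * r.+1)%N.
    by move: (bin2_dbl r); rewrite /Qnat; nia.
  have sg : (-1) ^+ (r.+1.*2 + r.+1) = (-1) ^+ r.+1 :> fps laurent.
    by rewrite exprD -mul2n exprM sqrrN !expr1n mul1r.
  rewrite Q0 Q1 add0n -doubleS sg /sgnq; move: 'C(_, _) => c.
  rewrite -(exprM q 2 c) -!mul2n; move: (2 * c)%N => d.
  rewrite !exprD !exprM expr1.
  by move: (x ^+ r.+1) ((-1) ^+ r.+1) => a b; ring.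
by rewrite [RHS]addrCA [in RHS]/bump /= add1n.
Qed.

(** Partial fractions with y = q^(2r+1): (1 - y^2)/((1 + zeta y)(1 + zeta^-1 y)) = 1/(1 + zeta y) -
    zeta^-1 y/(1 + zeta^-1 y). The numerator is the factor 1 - x^(2r+1), and the last fraction is
    the expansion for exponent -(2r+1). *)
Lemma bailey_termE r : q * bailey_term r
  = \sum_(i < r.*2.+1) (-1) ^+ (i + r) * q ^+ Qnat r i * inv1Dzq (r.*2.+1)%:Z
    - \sum_(i < r.*2.+1) (-1) ^+ (i + r) * q ^+ Qnat r i * inv1Dzq (- (r.*2.+1)%:Z).
Proof.
rewrite -!mulr_suml -mulrBr -bailey_alphaE inv1Dzq_pos inv1Dzq_neg /bailey_term.
set y := q ^+ r.*2.+1.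
have u := mulrV (unit_1Dwq zeta r.*2); have v := mulrV (unit_1Dwq zeta^-1 r.*2).
rewrite -/y in u v *.
have -> : x ^+ r.*2.+1 = y * y by rewrite -exprM mul2n -addnn exprD.
move: (1 + zeta * y)^-1 (1 + zeta^-1 * y)^-1 u v => c d u v.
have -> : c - zeta^-1 * y * d
    = c * ((1 + zeta^-1 * y) * d) - zeta^-1 * y * (((1 + zeta * y) * c) * d).
  by rewrite u v mul1r mulr1.
have -> : c * ((1 + zeta^-1 * y) * d) - zeta^-1 * y * (((1 + zeta * y) * c) * d)
    = (1 - zeta * zeta^-1 * (y * y)) * (c * d) by ring.
by rewrite zetaK mul1r; ring.
Qed.

Lemma Qexp_eq (r s e : int) : Qrat r s = e%:~R -> Qexp r s = e.
Proof. by rewrite /Qexp => ->; apply: intrKfloor. Qed.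

Lemma QnatE r i : (i < r.*2.+1)%N ->
  (r%:Z ^+ 2 + 5 * r%:Z + 1 + 6 * i%:Z * r%:Z - 3 * i%:Z ^+ 2 - i%:Z = Qnat r i).
Proof.
rewrite ltnS => ir; have : (i * i <= i * r.*2)%N by rewrite leq_mul2l ir orbT.
rewrite /Qnat; nia.
Qed.

Lemma Qexp_pos r i : (i < r.*2.+1)%N -> Qexp i (r.*2%:Z - i%:Z) = Qnat r i.
Proof.
move=> ir; rewrite -QnatE // -mul2n; apply: Qexp_eq.
by rewrite /Qrat PoszM !(rmorphD, rmorphM, rmorphXn, rmorphB) /=; field.
Qed.

Lemma Qexp_neg r i : (i < r.*2.+1)%N ->
  Qexp (- 1 - (r.*2%:Z - i%:Z)) (- 1 - i%:Z) = Qnat r i.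
Proof.
move=> ir; rewrite -QnatE // -mul2n; apply: Qexp_eq.
by rewrite /Qrat PoszM !(rmorphD, rmorphM, rmorphXn, rmorphB, rmorphN) /=; field.
Qed.

Lemma exprz_sgnB (i r : nat) : (-1) ^ (i%:Z - r%:Z) = (-1) ^+ (i + r) :> fps laurent.
Proof.
by rewrite exprzDr ?unitrN1 // -exprz_inv invrN1 exprD.
Qed.

(** Equal parity allows summing each cone along finite rows of constant r + s: 2R in the positive
    cone, -2R - 2 in the negative one. The reflection (r, s) -> (-1 - s, -1 - r) matches the rows,
    keeping Q and the sign and negating r + s + 1. *)
Lemma indefinite_theta_identity :
  S = J / qpoch_inf [:: x] x ^+ 2 *
      (let F := fun p : int * int => let: (r, s) := p in
         (-1) ^ ((r - s) %/ 2)%Z * q ^ Qexp r s * inv1Dzq (r + s + 1) in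
       fps_sum [set p : int * int |
         [/\ 0 <= p.1, 0 <= p.2 & (p.1 = p.2 %[mod 2])%Z]] F
       - fps_sum [set p : int * int |
         [/\ p.1 < 0, p.2 < 0 & (p.1 = p.2 %[mod 2])%Z]] F).
Proof.
rewrite generating_function_bailey qpoch_inf_qfact.
rewrite expr2 invrM ?(qfact_inf_unit coefs_x0) //.
apply: (congr1 (fun f => _ * f)).
have Fpos r i : (i < r.*2.+1)%N ->
    (-1) ^ ((i%:Z - (r.*2%:Z - i%:Z)) %/ 2)%Z * q ^ Qexp i (r.*2%:Z - i%:Z)
      * inv1Dzq (i%:Z + (r.*2%:Z - i%:Z) + 1)
    = (-1) ^+ (i + r) * q ^+ Qnat r i * inv1Dzq (r.*2.+1)%:Z.
  move=> ir; rewrite Qexp_pos //.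
  have -> : ((i%:Z - (r.*2%:Z - i%:Z)) %/ 2)%Z = i%:Z - r%:Z.
    have -> : i%:Z - (r.*2%:Z - i%:Z) = (i%:Z - r%:Z) * 2 by lia.
    by rewrite mulzK.
  have -> : i%:Z + (r.*2%:Z - i%:Z) + 1 = (r.*2.+1)%:Z by lia.
  by rewrite exprz_sgnB.
have Fneg r i : (i < r.*2.+1)%N ->
    (-1) ^ ((- 1 - (r.*2%:Z - i%:Z) - (- 1 - i%:Z)) %/ 2)%Z
      * q ^ Qexp (- 1 - (r.*2%:Z - i%:Z)) (- 1 - i%:Z)
      * inv1Dzq (- 1 - (r.*2%:Z - i%:Z) + (- 1 - i%:Z) + 1)
    = (-1) ^+ (i + r) * q ^+ Qnat r i * inv1Dzq (- (r.*2.+1)%:Z).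
  move=> ir; rewrite Qexp_neg //.
  have -> : ((- 1 - (r.*2%:Z - i%:Z) - (- 1 - i%:Z)) %/ 2)%Z = i%:Z - r%:Z.
    have -> : - 1 - (r.*2%:Z - i%:Z) - (- 1 - i%:Z) = (i%:Z - r%:Z) * 2 by lia.
    by rewrite mulzK.
  have -> : - 1 - (r.*2%:Z - i%:Z) + (- 1 - i%:Z) + 1 = - (r.*2.+1)%:Z by lia.
  by rewrite exprz_sgnB.
(* The exponent equals r^2 + 5r + 1 + 3i(2r - i) - i. *)
have Qr r i : (i < r.*2.+1)%N -> (r <= Qnat r i)%N.
  rewrite ltnS => ir; have : (i * i <= i * r.*2)%N by rewrite leq_mul2l ir orbT.
  by rewrite /Qnat; nia.
have sm r i a b : (i < r.*2.+1)%N -> small r (a * q ^+ Qnat r i * b).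
  by move=> ir; apply/smallMr/smallMl/small_qX/Qr.
rewrite /=.
rewrite (@fps_sum_finite_rows _ _ _ _
    (fun r i : nat => (i%:Z, r.*2%:Z - i%:Z)) _ (fun r => r.*2.+1)); first last.
- by move=> r i ir; rewrite Fpos //; apply: sm.
- move=> [[a|a] [b|b]] [] //= _ _ ab; exists ((a + b)./2), a.
  by split; [|congr (_, _)]; lia.
- by move=> r i ir; split => /=; lia.
- by move=> r i r' i' [-> H]; split => //; lia.
rewrite (@fps_sum_finite_rows _ _ _ _
    (fun r i : nat => (- 1 - (r.*2%:Z - i%:Z), - 1 - i%:Z)) _ (fun r => r.*2.+1)); first last.
- by move=> r i ir; rewrite Fneg //; apply: sm.
- move=> [[a|a] [b|b]] [] //= _ _ ab; exists ((a + b)./2), b.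
  by split; [|congr (_, _)]; lia.
- by move=> r i ir; split => /=; lia.
- by move=> r i r' i' [H1 H2]; split; lia.
rewrite -fps_sumB.
- apply: fps_sum_ext => r _; rewrite bailey_termE; congr (_ - _).
  + by apply: eq_bigr => i _; rewrite Fpos.
  + by apply: eq_bigr => i _; rewrite Fneg.
- by move=> r; apply: small_sum => i _; rewrite Fpos //; apply: sm.
- by move=> r; apply: small_sum => i _; rewrite Fneg //; apply: sm.
Qed.

(** * Odd strongly unimodal sequences *)

Fixpoint odd_chains (n : nat) : seq (seq nat) :=
  if n is n'.+1 then
    odd_chains n' ++ [seq rcons a n'.*2.+1 | a <- odd_chains n']
  else [:: [::]].

Lemma mem_odd_chains n a : (a \in odd_chains n)
  = [&& all odd a, pairwise ltn a & all (fun y => y < n.*2.+1)%N a].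
Proof.
elim: n a => [|n IH] a.
  rewrite /= inE; apply/eqP/and3P => [->//|[]].
  by case: a => [|y a] //= /andP[oy _] _ /andP[y0]; case: y oy y0.
rewrite mem_cat IH; apply/idP/idP.
  case/orP => [/and3P[-> -> /= lt]|/mapP[b]].
    by apply: sub_all lt => y /=; lia.
  rewrite IH => /and3P[ob pb lt] ->.
  rewrite all_rcons ob pairwise_rcons pb lt /= !all_rcons /= odd_double /=.
  by rewrite ltnS doubleS leqW //=; apply: sub_all lt => y /=; lia.
case/lastP: a => [|a y]; first by [].
rewrite !all_rcons pairwise_rcons => /and3P[/andP[oy oa] /andP[ay pa] /andP[yn _]].
have [yE|yn'] := eqVneq y n.*2.+1.
  apply/orP; right; rewrite yE; apply/map_f; rewrite IH oa pa.
  by rewrite yE in ay.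
have lt : (y < n.*2.+1)%N by lia.
rewrite oy oa ay pa lt /=; apply/orP; left.
by apply: sub_all ay => z /= zy; apply: ltn_trans lt.
Qed.

Lemma uniq_odd_chains n : uniq (odd_chains n).
Proof.
elim: n => //= n IH; rewrite cat_uniq IH map_inj_uniq ?IH ?andbT; last first.
  by move=> a b /rcons_inj[].
apply/hasPn => _ /mapP[a _ ->] /=.
by rewrite mem_odd_chains !all_rcons ltnn !andbF.
Qed.

(** [odd_chains] decides at each step whether the next odd number is an entry, just as one more
    factor offers 1 or w q^(2j+1). *)
Lemma sum_odd_chains w n :
  \sum_(a <- odd_chains n) w ^+ size a * q ^+ sumn a
  = \prod_(j < n) (1 + w * q ^+ j.*2.+1).
Proof.
elim: n => [|n IH]; first by rewrite big_ord0 big_seq1 mulr1.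
rewrite big_ord_recr -IH /= big_cat big_map mulrDr mulr1 mulr_suml.
congr (_ + _); apply: eq_bigr => a _.
by rewrite size_rcons sumn_rcons exprD (exprS w); ring.
Qed.

(** A code (k, (a, b)) stands for the peak 2k + 1 with left flank a and right flank b reversed, so
    that both flanks are increasing chains. *)
Definition unimodal_codes (K : nat) : seq (nat * (seq nat * seq nat)) :=
  [seq (k, p) | k <- iota 0 K, p <- [seq (a, b) | a <- odd_chains k, b <- odd_chains k]].

Definition code_seq (t : nat * (seq nat * seq nat)) : seq nat :=
  t.2.1 ++ t.1.*2.+1 :: rev t.2.2.

Definition code_rank (t : nat * (seq nat * seq nat)) : int :=
  (size t.2.1)%:Z - (size t.2.2)%:Z.

Lemma sum_codes k :
  \sum_(p <- [seq (a, b) | a <- odd_chains k, b <- odd_chains k])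
     zeta ^ code_rank (k, p) * q ^+ sumn (code_seq (k, p))
  = poch k * q ^+ (2 * k + 1).
Proof.
rewrite big_allpairs pochE -!sum_odd_chains mulr_suml mulr_suml.
apply: eq_bigr => a _; rewrite mulr_sumr mulr_suml; apply: eq_bigr => b _.
rewrite /code_rank /code_seq /= sumn_cat /= sumn_rev.
rewrite exprzDr ?zeta_unit // -exprz_inv -!exprnP.
have -> : (sumn a + (k.*2.+1 + sumn b) = sumn a + sumn b + (2 * k + 1))%N by lia.
by rewrite !exprD; ring.
Qed.

Lemma mem_codes K k a b : ((k, (a, b)) \in unimodal_codes K)
  = [&& (k < K)%N, a \in odd_chains k & b \in odd_chains k].
Proof.
apply/allpairsPdep/and3P => [[k' [p [kK pk E]]]|[kK ak bk]].
  case: E kK pk => <- <-; rewrite mem_iota => /= kK.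
  by case/allpairsP => -[a' b'] /= [? ? [-> ->]].
exists k, (a, b); rewrite mem_iota; split => //.
by apply/allpairsP; exists (a, b).
Qed.

Lemma uniq_codes K : uniq (unimodal_codes K).
Proof.
apply: allpairs_uniq_dep.
- exact: iota_uniq.
- move=> k _; apply: allpairs_uniq; try exact: uniq_odd_chains.
  by move=> [a b] [a' b'].
- by move=> [k p] [k' p'] _ _ /= [<- <-].
Qed.

Lemma odd_chains_lt k a y : a \in odd_chains k -> y \in a -> (y < k.*2.+1)%N.
Proof. by rewrite mem_odd_chains => /and3P[_ _ /allP]; apply. Qed.

(** The peak is the largest entry, hence determined; its first occurrence then fixes the length of
    the left flank. *)
Lemma code_seq_inj K : {in unimodal_codes K &, injective code_seq}.
Proof.
move=> [k [a b]] [k' [a' b']]; rewrite !mem_codes => /and3P[_ ak bk] /and3P[_ ak' bk'].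
rewrite /code_seq /= => E.
have le (l l' : nat) (c d c' d' : seq nat) : c' \in odd_chains l' -> d' \in odd_chains l' ->
    c ++ l.*2.+1 :: rev d = c' ++ l'.*2.+1 :: rev d' -> (l <= l')%N.
  move=> cl dl F.
  have : l.*2.+1 \in c' ++ l'.*2.+1 :: rev d'.
    by rewrite -F mem_cat inE eqxx orbT.
  rewrite mem_cat inE mem_rev => /or3P[/(odd_chains_lt cl)|/eqP|/(odd_chains_lt dl)]; lia.
have kk : k = k'.
  apply/eqP; rewrite eqn_leq.
  by rewrite (le _ _ _ _ _ _ ak' bk' E) (le _ _ _ _ _ _ ak bk (esym E)).
subst k'.
have idx c d : c \in odd_chains k -> index k.*2.+1 (c ++ k.*2.+1 :: d) = size c.
  move=> ck; rewrite index_cat ifF /= ?eqxx ?addn0 //.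
  by apply/negP => /(odd_chains_lt ck); rewrite ltnn.
have sz : size a = size a' by rewrite -(idx a (rev b) ak) E idx.
move/eqP: E; rewrite eqseq_cat // => /andP[/eqP -> /eqP [/(can_inj revK) ->]].
by [].
Qed.

(** The bound [n.+1] on codes is harmless, since weight n forces 2k + 1 <= n. *)
Lemma ou_setP m n s : ou_set m n s <->
  exists t, [/\ t \in unimodal_codes n.+1, code_seq t = s,
    sumn (code_seq t) = n & code_rank t = m].
Proof.
split=> [[a [c [b [-> /and3P[]]]]]|[[k [a b]] [+ <- sE rE]]].
  rewrite all_cat /= => /and3P[oa oc ob] sa sb sE rE.
  have cE : c = (c./2).*2.+1 by move: (odd_double_half c); rewrite oc; lia.
  have E : code_seq (c./2, (a, rev b)) = a ++ c :: b.
    by rewrite /code_seq /= revK -cE.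
  exists (c./2, (a, rev b)); split; rewrite ?E //; last first.
    by rewrite /code_rank /= size_rev.
  move: sa; rewrite (sorted_pairwise ltn_trans) pairwise_rcons => /andP[lta pa].
  have : sorted ltn (rcons (rev b) c) by rewrite -rev_cons rev_sorted.
  rewrite (sorted_pairwise ltn_trans) pairwise_rcons => /andP[ltb pb].
  rewrite mem_codes !mem_odd_chains -cE oa pa lta pb ltb all_rev ob /= andbT.
  by move: sE; rewrite sumn_cat /=; lia.
rewrite mem_codes !mem_odd_chains => /and3P[kn /and3P[oa pa la] /and3P[ob pb lb]].
exists a, k.*2.+1, (rev b); split => //; last by rewrite size_rev.
apply/and3P; split.
- by rewrite all_cat /= all_rev oa ob /= odd_double.
- by rewrite (sorted_pairwise ltn_trans) pairwise_rcons la pa.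
- have : sorted ltn (rev (k.*2.+1 :: rev b)).
    by rewrite rev_cons revK (sorted_pairwise ltn_trans) pairwise_rcons lb pb.
  by rewrite rev_sorted.
Qed.

Lemma ouE m n : ou m n
  = count (fun t => (code_rank t == m) && (sumn (code_seq t) == n)) (unimodal_codes n.+1).
Proof.
set P := fun t => _.
pose s := map code_seq (filter P (unimodal_codes n.+1)).
have us : uniq s.
  rewrite map_inj_in_uniq ?filter_uniq ?uniq_codes // => t u.
  by rewrite !mem_filter => /andP[_ +] /andP[_]; apply: code_seq_inj.
have -> : ou m n = #|` [fset y in s]%fset|.
  rewrite /ou; congr (#|` _|); apply/fsetP => y.
  rewrite in_fset_set; last exact: finite_ou_set.
  rewrite in_fset; apply/idP/idP.
    rewrite inE => /ou_setP[t [tK tE sE rE]]; rewrite -tE; apply: map_f.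
    by rewrite mem_filter /P sE rE !eqxx.
  case/mapP => t; rewrite mem_filter => /andP[/andP[/eqP rE /eqP sE] tK] ->.
  by rewrite inE; apply/ou_setP; exists t.
by rewrite card_fseq undup_id // size_map size_filter.
Qed.

Lemma coefs_qMS (f : fps laurent) i : coefs (q * f) i.+1 = coefs f i.
Proof.
rewrite /= big_ord_recl mul0r add0r big_ord_recl /= mul1r subn1 big1 ?addr0 //.
by move=> j _; rewrite mul0r.
Qed.

Lemma coefs_mulqX (f : fps laurent) n i :
  coefs (f * q ^+ n) i = if (i < n)%N then 0 else coefs f (i - n).
Proof.
elim: n i => [|n IH] i; first by rewrite mulr1 subn0.
rewrite exprS mulrCA; case: i => [|i]; last by rewrite coefs_qMS IH.
by rewrite coefs0M mul0r.
Qed.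

(** The inverse of zeta is an abstractly chosen one, so its constancy is read off from [zetaK]: the
    higher coefficients are killed by [laurentX], which is invertible by the coefficient at 0. *)
Lemma coefs_zeta_exp (m : int) i : coefs (zeta ^ m) i.+1 = 0.
Proof.
have cM f g : (forall i, coefs f i.+1 = 0) -> (forall i, coefs g i.+1 = 0) ->
    forall i : nat, coefs (f * g : fps laurent) i.+1 = 0.
  move=> f0 g0 k; rewrite /= big_ord_recl big1 /= ?subn0 ?g0 ?mulr0 ?addr0 //.
  by move=> j _; rewrite f0 mul0r.
have cX f n : (forall i, coefs f i.+1 = 0) -> 
    forall i : nat, coefs (f ^+ n : fps laurent) i.+1 = 0.
  by move=> f0; elim: n => // n IH; rewrite exprS; apply: cM.
have cZ f k : coefs (zeta * f) k = laurentX * coefs f k.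
  by rewrite /= big_ord_recl big1 /= ?subn0 ?addr0 // => j _; rewrite mul0r.
have cV k : coefs zeta^-1 k.+1 = 0.
  have := congr1 (fun f => coefs f k.+1) zetaK.
  have := congr1 (fun f => coefs f 0%N) zetaK.
  rewrite !cZ /= => XV Xk; rewrite -[LHS]mul1r -[X in X * _]XV.
  by rewrite mulrAC Xk mul0r.
case: m => n; first by apply: cX.
by rewrite exprz_Negz; apply: cX.
Qed.

(** Both coefficients of q^N are sums over codes with k <= N, grouped by rank on the left and by
    peak on the right. *)
Lemma generating_function_ou :
  fps_sum [set: nat * int] (fun p => let: (n, m) := p in
    (ou m n)%:R * zeta ^ m * q ^+ n) = S.
Proof.
apply: fpsP => N.
rewrite coefs_fps_sum_nat; last by move=> n; apply/smallMl/small_qX; lia.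
pose T := unimodal_codes N.+1.
pose f t : laurent := coefs (zeta ^ code_rank t * q ^+ sumn (code_seq t)) N.
transitivity (\sum_(t <- T) f t); last first.
  rewrite /T /unimodal_codes big_allpairs_dep.
  rewrite -[iota 0 N.+1]/(index_iota 0 N.+1) big_mkord; apply: eq_bigr => k _.
  by rewrite -(sum_codes k) coefs_bigsum.
have term m : coefs ((ou m N)%:R * zeta ^ m * q ^+ N) N
    = \sum_(t <- T) (if code_rank t == m then f t else 0).
  rewrite ouE /T -mulrA mulr_natl.
  elim: (unimodal_codes _) => [|t s IH]; first by rewrite big_nil.
  rewrite big_cons /= mulrnDr coefs_fps_add IH; congr (_ + _).
  case: eqP => [<-|] //=; rewrite /f; case: eqP => [->|/eqP neq] //.
  rewrite coefs_mulqX; case: ltnP => // tN.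
  have -> : (N - sumn (code_seq t) = (N - sumn (code_seq t)).-1.+1)%N by lia.
  by rewrite coefs_zeta_exp.
(* Only the finitely many pairs (N, m) with m a rank that occurs contribute to q^N. *)
pose ms := undup (map code_rank T).
rewrite (@coefs_fps_sum_seq _ _ _ _ (map (pair N) ms)) //; first last.
- move=> [n m] _ /negP nms; rewrite coefs_mulqX; case: ltnP => // nN.
  have [nE|] := eqVneq n N; last first.
    move=> neq; have -> : (N - n = (N - n).-1.+1)%N by lia.
    rewrite mulr_natl; elim: (ou m n) => [|k IHk]; first by rewrite mulr0n.
    by rewrite mulrS coefs_fps_add IHk coefs_zeta_exp addr0.
  rewrite ouE (_ : count _ _ = 0%N) ?mul0r //.
  apply/eqP; rewrite -leqn0 leqNgt -has_count; apply/hasPn => t tT.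
  rewrite negb_and; apply/orP; left; apply/negP => /eqP rt; apply: nms.
  by rewrite nE in tT *; rewrite -rt; apply/map_f; rewrite mem_undup map_f.
- by rewrite map_inj_uniq ?undup_uniq // => m m' [].
rewrite big_map.
under eq_bigr => m _ do rewrite term.
rewrite exchange_big /= big_seq [RHS]big_seq; apply: eq_bigr => t tT.
have tm : code_rank t \in ms by rewrite mem_undup map_f.
rewrite (bigD1_seq (code_rank t)) ?undup_uniq //= eqxx.
by rewrite big1 ?addr0 // => m /negPf neq; rewrite eq_sym neq.
Qed.

End OddUnimodal.

Theorem theorem1p2 :
  let S : fps laurent :=
    fps_sum [set: nat] (fun n =>
      qpoch [:: - zeta * q; - zeta^-1 * q] (q ^+ 2) n * q ^+ (2 * n + 1)) in
  [/\ fps_sum [set: nat * int] (fun p => let: (n, m) := p in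
        (ou m n)%:R * zeta ^ m * q ^+ n) = S,
      S =
        - ((qpoch_inf [:: q ^+ 2] (q ^+ 2))^-1 *
           fps_sum [set: int] (fun n =>
             (-1) ^ n * q ^ (3 * n ^+ 2 + 3 * n + 1) * inv1Dzq (2 * n + 1)))
        + (qpoch_inf [:: q ^+ 2] (q ^+ 2))^-1 *
           fps_sum [set: int] (fun n =>
             zeta ^ (- n) * q ^ (n ^+ 2 + 2 * n + 1) * inv1Dzq (2 * n + 1)),
      S =
        q / qpoch_inf [:: q ^+ 2] (q ^+ 2) *
        (let F := fun p : int * int => let: (n, r) := p in
           (-1) ^ n * zeta ^ r *
             q ^ (3 * n ^+ 2 + 3 * n + 4 * n * r + r ^+ 2 + 2 * r) in
         fps_sum [set p : int * int | 0 <= p.1 /\ 0 <= p.2] F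
         - fps_sum [set p : int * int | p.1 < 0 /\ p.2 < 0] F)
    & S =
        qpoch_inf [:: - zeta * q; - zeta^-1 * q] (q ^+ 2)
          / qpoch_inf [:: q ^+ 2] (q ^+ 2) ^+ 2 *
        (let F := fun p : int * int => let: (r, s) := p in
           (-1) ^ ((r - s) %/ 2)%Z * q ^ Qexp r s * inv1Dzq (r + s + 1) in
         fps_sum [set p : int * int |
           [/\ 0 <= p.1, 0 <= p.2 & (p.1 = p.2 %[mod 2])%Z]] F
         - fps_sum [set p : int * int |
           [/\ p.1 < 0, p.2 < 0 & (p.1 = p.2 %[mod 2])%Z]] F)].
Proof.
move=> S; split.
- exact: generating_function_ou.
- exact: lerch_identity.
- exact: hecke_identity.
- exact: indefinite_theta_identity.
Qed.
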